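(* There is an absolute constant $C>0$ such that the following holds. Consider the distributed problem with $L$-Lipschitz gradients, the stochastic oracle with variance bound $\sigma^2$, and the LocalSGD algorithm with communication interval $\tau\ge 2$, $R\ge 1$ communication rounds and $T=\tau R$ iterations, all as described in the context. Let $\Delta=f(\bar{\mathbf x}_0)-f^*>0$. Assume: (i) (standard gradient similarity) for some $\zeta\ge 0$, $\sup_{\mathbf x\in\mathbb R^d}\frac1n\sum_{i=1}^n\|\nabla f_i(\mathbf x)-\nabla f(\mathbf x)\|_2^2\le\zeta^2$; (ii) (weak convexity) for some $\rho\in[0,L]$, the function $\mathbf x\mapsto f_i(\mathbf x)+\frac{\rho}{2}\mathbf x^{T}\mathbf x$ is convex for every $i\in\{1,\dots,n\}$. Then there exists a stepsize $\eta>0$ such that the iterates of LocalSGD satisfy $$\frac1T\sum_{t=0}^{T-1}\mathbb E\|\nabla f(\bar{\mathbf x}_t)\|_2^2\le C\left(\Big(\frac L\tau+\rho\Big)\frac{\Delta}{R}+\sqrt{\frac{L\Delta\sigma^2}{n\tau R}}+\Big(\frac{L\Delta\zeta}{R}\Big)^{2/3}+\frac{(L\Delta\sigma)^{2/3}}{\tau^{1/3}R^{2/3}}\right).$$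
   Context: Setting. There are $n\ge1$ workers and local functions $f_1,\dots,f_n:\mathbb R^d\to\mathbb R$ (possibly non-convex), each differentiable with $L$-Lipschitz continuous gradient, $L>0$. Put $f=\frac1n\sum_{i=1}^n f_i$, assumed bounded below, and $f^*=\inf_{\mathbf x\in\mathbb R^d}f(\mathbf x)$. Stochastic oracle. At iteration $t\in\{0,\dots,T-1\}$, worker $i$ at point $\mathbf x_t^i$ receives $\mathbf g_t^i=G_i(\mathbf x_t^i,\xi_t^i)$, where $G_i$ is a Borel function, the random variables $\xi_t^i$ are i.i.d. over $t$ for each $i$ and independent across workers $i$, and for all $\mathbf x\in\mathbb R^d$: $\mathbb E_{\xi_t^i}[G_i(\mathbf x,\xi_t^i)]=\nabla f_i(\mathbf x)$ and $\mathbb E_{\xi_t^i}\|G_i(\mathbf x,\xi_t^i)-\nabla f_i(\mathbf x)\|_2^2\le\sigma^2$. LocalSGD. Let $\tau\ge2$ be an integer (communication interval), $R\ge1$ the number of communication rounds, $T=\tau R$, $\eta>0$ the stepsize. Start from a common deterministic point $\mathbf x_0^1=\dots=\mathbf x_0^n$, and write $\bar{\mathbf x}_t=\frac1n\sum_{i=1}^n\mathbf x_t^i$. For each $i$ and $t\in\{0,\dots,T-1\}$: if $t+1$ is a multiple of $\tau$, then $\mathbf x_{t+1}^i=\bar{\mathbf x}_{t-\tau+1}-\frac{\eta}{n}\sum_{j=1}^n\sum_{k=0}^{\tau-1}\mathbf g_{t-k}^j$; otherwise $\mathbf x_{t+1}^i=\mathbf x_t^i-\eta\,\mathbf g_t^i$.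 The stepsize may depend on all the problem parameters ($L,\Delta,\sigma,\zeta,\rho,n,\tau,R$). *)

(* Defs.v *)
From HB Require Import structures.
From mathcomp Require Import all_boot all_order all_algebra.
From mathcomp Require Import all_classical all_reals all_analysis.
Set Implicit Arguments.
Unset Strict Implicit.
Unset Printing Implicit Defensive.
Import Order.TTheory GRing.Theory Num.Theory.
Import numFieldNormedType.Exports.
Local Open Scope classical_set_scope.
Local Open Scope ring_scope.

(* The library's norm on ['rV[R]_d] is the max norm, hence these. *)
Definition sqnorm2 (R : realType) (d : nat) (v : 'rV[R]_d) : R :=
  \sum_(j < d) v ord0 j ^+ 2.

Definition norm2 (R : realType) (d : nat) (v : 'rV[R]_d) : R :=
  Num.sqrt (sqnorm2 v).

(* Only meaningful at points where [f] is differentiable. *)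
Definition grad (R : realType) (d : nat) (f : 'rV[R]_d -> R) (x : 'rV[R]_d) :
    'rV[R]_d :=
  \row_(j < d) ('d f x (delta_mx ord0 j : 'rV[R]_d)).

Definition lipschitz_gradient (R : realType) (d : nat) (L : R)
    (f : 'rV[R]_d -> R) : Prop :=
  (forall x : 'rV[R]_d, differentiable f x) /\
  (forall x y : 'rV[R]_d, norm2 (grad f x - grad f y) <= L * norm2 (x - y)).

Definition weakly_convex (R : realType) (d : nat) (rho : R)
    (f : 'rV[R]_d -> R) : Prop :=
  convex_function [set: 'rV[R]_d] (fun x => f x + rho / 2 * sqnorm2 x).

Definition avg_fun (R : realType) (d n : nat) (f : 'I_n -> 'rV[R]_d -> R)
    (x : 'rV[R]_d) : R :=
  n%:R^-1 * \sum_(i < n) f i x.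

Definition grad_similarity (R : realType) (d n : nat) (zeta : R)
    (f : 'I_n -> 'rV[R]_d -> R) : Prop :=
  (ereal_sup (range (fun x : 'rV[R]_d =>
     (n%:R^-1 * \sum_(i < n) sqnorm2 (grad (f i) x - grad (avg_fun f) x))%:E))
   <= (zeta ^+ 2)%:E)%E.

Definition borel_rV (R : realType) (d : nat) :=
  g_sigma_algebraType [set A : set 'rV[R]_d | open A].

(* Finite index set; the random variables may live in different spaces. *)
Definition mutually_independent (R : realType) (dO dX : measure_display)
    (Omega : measurableType dO) (P : probability Omega R) (I : finType)
    (Xi : I -> measurableType dX) (X : forall k : I, Omega -> Xi k) : Prop :=
  forall (J : {set I}) (B : forall k : I, set (Xi k)),
    (forall k : I, measurable (B k)) ->
    P (\bigcap_(k in [set` J]) (X k @^-1` B k)) =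
    (\prod_(k in J) P (X k @^-1` B k))%E.

Definition identically_distributed (R : realType) (dO dX : measure_display)
    (Omega : measurableType dO) (P : probability Omega R)
    (Xi : measurableType dX) (X Y : {RV P >-> Xi}) : Prop :=
  forall B : set Xi, measurable B -> distribution P X B = distribution P Y B.

(* [xi i t] is the randomness used by worker [i] at iteration [t]; only the
   indices [t < T] are constrained. *)
Definition iid_noise (R : realType) (dO dX : measure_display)
    (Omega : measurableType dO) (P : probability Omega R) (n T : nat)
    (Xi : 'I_n -> measurableType dX)
    (xi : forall i : 'I_n, nat -> {RV P >-> Xi i}) : Prop :=
  (forall (i : 'I_n) (s t : nat), (s < T)%N -> (t < T)%N ->
     identically_distributed (xi i s) (xi i t)) /\
  mutually_independent P (fun k : 'I_n * 'I_T => (xi k.1 k.2 : Omega -> Xi k.1)).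

Definition has_mean (R : realType) (dO : measure_display)
    (Omega : measurableType dO) (P : probability Omega R) (d : nat)
    (X : Omega -> 'rV[R]_d) (m : 'rV[R]_d) : Prop :=
  forall j : 'I_d,
    P.-integrable [set: Omega] (fun w => (X w ord0 j)%:E) /\
    ('E_P[fun w => X w ord0 j] = (m ord0 j)%:E)%E.

Definition stochastic_oracle (R : realType) (dO dX : measure_display)
    (Omega : measurableType dO) (P : probability Omega R) (d n T : nat)
    (Xi : 'I_n -> measurableType dX)
    (xi : forall i : 'I_n, nat -> {RV P >-> Xi i})
    (f : 'I_n -> 'rV[R]_d -> R)
    (G : forall i : 'I_n, 'rV[R]_d -> Xi i -> 'rV[R]_d) (sigma : R) : Prop :=
  [/\ (forall i : 'I_n,
        measurable_fun [set: borel_rV R d * Xi i]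
          (fun p : borel_rV R d * Xi i => G i p.1 p.2 : borel_rV R d)),
      iid_noise T xi,
      (forall (i : 'I_n) (t : nat) (x : 'rV[R]_d), (t < T)%N ->
        has_mean P (fun w => G i x (xi i t w)) (grad (f i) x)) &
      (forall (i : 'I_n) (t : nat) (x : 'rV[R]_d), (t < T)%N ->
        ('E_P[fun w => sqnorm2 (G i x (xi i t w) - grad (f i) x)]
           <= (sigma ^+ 2)%:E)%E)].

Definition worker_mean (R : realType) (Omega : Type) (d n : nat)
    (x : nat -> 'I_n -> Omega -> 'rV[R]_d) (t : nat) (w : Omega) : 'rV[R]_d :=
  n%:R^-1 *: \sum_(i < n) x t i w.

(* [x t i w] is the iterate of worker [i]. The subtractions on [nat] do not
   truncate, since [tau %| t.+1] forces [tau <= t.+1]. *)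
Definition LocalSGD (R : realType) (Omega : Type) (d n tau T : nat) (eta : R)
    (Xi : 'I_n -> Type) (xi : forall i : 'I_n, nat -> Omega -> Xi i)
    (G : forall i : 'I_n, 'rV[R]_d -> Xi i -> 'rV[R]_d) (x0 : 'rV[R]_d)
    (x : nat -> 'I_n -> Omega -> 'rV[R]_d) : Prop :=
  let g (t : nat) (i : 'I_n) (w : Omega) := G i (x t i w) (xi i t w) in
  (forall (i : 'I_n) (w : Omega), x 0%N i w = x0) /\
  (forall (t : nat) (i : 'I_n) (w : Omega), (t < T)%N ->
     x t.+1 i w =
       if (tau %| t.+1)%N then
         worker_mean x (t.+1 - tau) w
         - (eta / n%:R) *: \sum_(j < n) \sum_(k < tau) g (t - k)%N j w
       else x t i w - eta *: g t i w).

(* Main.v *)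
Require Import Defs.
From HB Require Import structures.
From mathcomp Require Import all_boot all_order all_algebra.
From mathcomp Require Import all_classical all_reals all_analysis.
From mathcomp Require Import measurable_realfun.
From mathcomp Require Import zify ring lra.
Set Implicit Arguments.
Unset Strict Implicit.
Unset Printing Implicit Defensive.
Import Order.TTheory GRing.Theory Num.Theory.
Import numFieldNormedType.Exports.
Local Open Scope classical_set_scope.
Local Open Scope ring_scope.

(** The argument has a deterministic, a probabilistic and a numerical part.

    Let [xbar t] be the mean of the workers' iterates.  Whether or not a
    communication takes place, [xbar] moves along the average stochastic
    gradient ([mean_step]), so that the descent lemma for the average [F] of the
    local functions bounds the expected decrease of [F] at [xbar] in terms of
    the squared gradient norm of [F], of the variance [sigma ^+ 2 / n] of the
    averaged noise, and of [L ^+ 2] times the spread [D t], the mean square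
    distance of the workers to [xbar t] ([descent_step], [mean_descent_step]).

    Weak convexity serves to control the spread with a stepsize much larger than
    [1 / (L * tau)].  For an [L]-smooth function [f] with
    [f + rho / 2 * sqnorm2] convex, the gradient differences [a] over
    displacements [e] satisfy
    [dot a e >= sqnorm2 a / (4 * L) - 3 / 2 * rho * sqnorm2 e]
    ([weakly_cocoercive]); for [4 * L * eta <= 1] the first term absorbs the
    quadratic term of a gradient step, which therefore expands distances at a
    rate governed by [rho] instead of [L] ([cocoercive_step]).  Comparing
    worker [i] with the fictitious step of [xbar t] along the gradient of [F]
    leaves only the dissimilarity of the gradients at [xbar t], and replacing
    the fictitious step by the actual mean can only decrease the total of the
    square distances.  Hence ([consensus_step], [mean_spread_step])
    [E D (t + 1) <= (1 + 2 / tau) * E D t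
                    + eta ^+ 2 * (2 * tau * zeta ^+ 2 + sigma ^+ 2)]
    whenever [4 * rho * eta * tau <= 1].  As [D] vanishes at each
    communication, [tau] steps accumulate at most
    [expR 2 * eta ^+ 2 * (2 * tau ^+ 2 * zeta ^+ 2 + tau * sigma ^+ 2)]
    ([mean_spread]).

    The cross terms between noise and iterates vanish in expectation: the
    variable used by worker [i] at iteration [t] is independent of the sigma
    algebra generated by all the other ones, for which every iterate up to time
    [t] and the noise of every other worker at time [t] are measurable.  The
    joint law of an independent pair being a product measure, Tonelli and Fubini
    then let the hypotheses on the oracle be used with the iterate frozen
    ([mean_sqnorm2_noise], [mean_dot_noise]).

    Telescoping the descent bounds the average squared gradient norm by
    [2 * Delta / (eta * T)] plus terms of order [eta] and [eta ^+ 2]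
    ([sum_mean_sqnorm2_grad]); [1 / eta] is chosen as the sum of
    [4 * (L + rho * tau)] and of the three values that balance the remaining
    terms ([stepsize], [stepsize_rate]). *)

(** * The Euclidean inner product and the gradient *)

Section Euclidean.
Context {R : realType} {d : nat}.
Implicit Types u v w : 'rV[R]_d.

(** The Euclidean inner product, whose square norm is [sqnorm2]. *)
Definition dot u v : R := \sum_(j < d) u ord0 j * v ord0 j.

Lemma dotvv u : dot u u = sqnorm2 u.
Proof. by apply: eq_bigr => j _; rewrite expr2. Qed.

Lemma dotC u v : dot u v = dot v u.
Proof. by apply: eq_bigr => j _; rewrite mulrC. Qed.

Lemma dotDl u v w : dot (u + v) w = dot u w + dot v w.
Proof. by rewrite /dot -big_split; apply: eq_bigr => j _; rewrite mxE mulrDl. Qed.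

Lemma dotZl a u v : dot (a *: u) v = a * dot u v.
Proof. by rewrite /dot mulr_sumr; apply: eq_bigr => j _; rewrite mxE mulrA. Qed.

Lemma dotDr u v w : dot u (v + w) = dot u v + dot u w.
Proof. by rewrite dotC dotDl !(dotC u). Qed.

Lemma dotZr a u v : dot u (a *: v) = a * dot u v.
Proof. by rewrite dotC dotZl dotC. Qed.

Lemma dotNl u v : dot (- u) v = - dot u v.
Proof. by rewrite -scaleN1r dotZl mulN1r. Qed.

Lemma dotNr u v : dot u (- v) = - dot u v.
Proof. by rewrite dotC dotNl dotC. Qed.

Lemma dot0l v : dot 0 v = 0.
Proof. by rewrite -(scale0r (0 : 'rV[R]_d)) dotZl mul0r. Qed.

Lemma dot_suml (I : finType) (F : I -> 'rV[R]_d) v :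
  dot (\sum_i F i) v = \sum_i dot (F i) v.
Proof. by apply: (big_morph (dot^~ v)) => [x y|]; [exact: dotDl|exact: dot0l]. Qed.

Lemma dot_sumr (I : finType) (F : I -> 'rV[R]_d) v :
  dot v (\sum_i F i) = \sum_i dot v (F i).
Proof. by rewrite dotC dot_suml; apply: eq_bigr => i _; exact: dotC. Qed.

Lemma sqnorm2_ge0 u : 0 <= sqnorm2 u.
Proof. by apply: sumr_ge0 => j _; exact: sqr_ge0. Qed.

Lemma sqnorm2_0 : sqnorm2 (0 : 'rV[R]_d) = 0.
Proof. by rewrite -dotvv dot0l. Qed.

Lemma sqnorm2D u v : sqnorm2 (u + v) = sqnorm2 u + 2 * dot u v + sqnorm2 v.
Proof. rewrite -!dotvv !dotDl !dotDr (dotC v u); ring. Qed.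

Lemma sqnorm2B u v : sqnorm2 (u - v) = sqnorm2 u - 2 * dot u v + sqnorm2 v.
Proof. rewrite -!dotvv !dotDl !dotDr !dotNr !dotNl (dotC v u); ring. Qed.

Lemma sqnorm2Z a u : sqnorm2 (a *: u) = a ^+ 2 * sqnorm2 u.
Proof. rewrite -!dotvv dotZl dotZr; ring. Qed.

Lemma sqnorm2N u : sqnorm2 (- u) = sqnorm2 u.
Proof. by rewrite -scaleN1r sqnorm2Z sqrrN expr1n mul1r. Qed.

(** Young's inequality. *)
Lemma dot_young a u v : 0 < a ->
  2 * dot u v <= a * sqnorm2 u + a^-1 * sqnorm2 v.
Proof.
move=> a0; have := sqnorm2_ge0 (a *: u - v).
rewrite sqnorm2B sqnorm2Z dotZl => h.
have : 0 <= a^-1 * (a ^+ 2 * sqnorm2 u - 2 * (a * dot u v) + sqnorm2 v).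
  by rewrite mulr_ge0// invr_ge0 ltW.
have -> : a^-1 * (a ^+ 2 * sqnorm2 u - 2 * (a * dot u v) + sqnorm2 v)
    = a * sqnorm2 u - 2 * dot u v + a^-1 * sqnorm2 v.
  by field; rewrite gt_eqF.
lra.
Qed.

Lemma sqnorm2D_le u v : sqnorm2 (u + v) <= 2 * sqnorm2 u + 2 * sqnorm2 v.
Proof.
have := dot_young u v (@ltr01 R); rewrite sqnorm2D invr1 !mul1r; lra.
Qed.

Lemma sqr_norm2 u : norm2 u ^+ 2 = sqnorm2 u.
Proof. by rewrite sqr_sqrtr// sqnorm2_ge0. Qed.

Lemma sqr_coord_le u j : u ord0 j ^+ 2 <= sqnorm2 u.
Proof.
rewrite /sqnorm2 (bigD1 j)//= lerDl; apply: sumr_ge0 => i _; exact: sqr_ge0.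
Qed.

(** Among all centres, the mean minimizes the sum of the square distances; here
    it is compared with the origin. *)
Lemma sum_sqnorm2_center (n : nat) (z : 'I_n -> 'rV[R]_d) : (0 < n)%N ->
  \sum_(i < n) sqnorm2 (z i - n%:R^-1 *: \sum_(j < n) z j)
  <= \sum_(i < n) sqnorm2 (z i).
Proof.
move=> n0; set m := n%:R^-1 *: _.
have nm : \sum_(j < n) z j = n%:R *: m.
  by rewrite scalerA mulfV ?scale1r// pnatr_eq0 -lt0n.
under eq_bigr => i _ do rewrite sqnorm2B.
rewrite !big_split/= sumr_const card_ord sumrN -mulr_sumr -dot_suml nm dotZl dotvv.
rewrite -[_ *+ n]mulr_natl.
have : 0 <= n%:R * sqnorm2 m by rewrite mulr_ge0// sqnorm2_ge0.
lra.
Qed.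

End Euclidean.

Section Gradient.
Context {R : realType} {d : nat}.
Implicit Types (f : 'rV[R]_d -> R) (x v : 'rV[R]_d).

Lemma gradE f x j : grad f x ord0 j = 'd f x (delta_mx ord0 j).
Proof. by rewrite mxE. Qed.

Lemma diff_dot f x v : differentiable f x -> 'd f x v = dot (grad f x) v.
Proof.
move=> df.
rewrite [in LHS](matrix_sum_delta v) linear_sum/= big_ord1 linear_sum/=.
by apply: eq_bigr => j _; rewrite linearZ/= mxE mulrC.
Qed.

Lemma is_derive_line f x v (t : R) : differentiable f (x + t *: v) ->
  is_derive t (1 : R) (fun s : R => f (x + s *: v)) (dot (grad f (x + t *: v)) v).
Proof.
move=> df.
have dl : is_diff t (fun s : R => x + s *: v) (fun s : R => s *: v).
  have -> : (fun s : R => s *: v) = 0 + (fun s : R => s *: v).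
    by apply/funext => s; rewrite /= add0r.
  by apply: is_diffD.
have dfl : differentiable (f \o (fun s : R => x + s *: v)) t.
  by apply: differentiable_comp => //; case: dl.
apply: DeriveDef; first exact/derivable1_diffP.
have [dl1 dl2] := dl.
rewrite -(diff_dot _ df) deriveE// diff_comp// dl2 /=.
by rewrite scale1r.
Qed.

End Gradient.

(** * Smoothness and weak convexity *)

Section Smooth.
Context {R : realType} {d : nat}.
Implicit Types (f : 'rV[R]_d -> R) (x y v : 'rV[R]_d) (L rho : R).

Lemma lipschitz_gradient_sqr L f x y : 0 <= L -> lipschitz_gradient L f ->
  sqnorm2 (grad f x - grad f y) <= L ^+ 2 * sqnorm2 (x - y).
Proof.
move=> L0 [_ /(_ x y) h].
by rewrite -!sqr_norm2 -exprMn ler_sqr// nnegrE ?mulr_ge0// sqrtr_ge0.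
Qed.

Lemma lipschitz_gradient_dot L f x y : 0 < L -> lipschitz_gradient L f ->
  dot (grad f x - grad f y) (x - y) <= L * sqnorm2 (x - y).
Proof.
move=> L0 lf; have := lipschitz_gradient_sqr x y (ltW L0) lf.
have Li : 0 < L^-1 by rewrite invr_gt0.
have := dot_young (grad f x - grad f y) (x - y) Li.
set u := sqnorm2 (grad f x - grad f y); set w := sqnorm2 (x - y).
rewrite invrK => h1 /(ler_wpM2l (ltW Li)).
rewrite mulrA expr2 mulrA mulVf ?mul1r ?gt_eqF//; lra.
Qed.

(** The descent lemma, by the mean value theorem along the segment from [x] to
    [x + v]. *)
Lemma descent_lemma L f x v : 0 < L -> lipschitz_gradient L f ->
  f (x + v) <= f x + dot (grad f x) v + L / 2 * sqnorm2 v.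
Proof.
(* Real arithmetic is done over variables, as a comparison of gradients at two
   points by conversion may not end in reasonable time. *)
have aux (c p q r s w : R) :
  r - (q + L / 2 * w) - s = p - (q + 2 * c * (L / 2 * w)) ->
  p - q <= L * c * w -> r <= s + q + L / 2 * w by lra.
move=> L0 lf; have df := lf.1.
(* [phi] is [f] along the segment minus the announced upper bound; its
   derivative [dphi] is nonpositive. *)
pose phi := fun s : R => f (x + s *: v)
  - (s * dot (grad f x) v + s ^+ 2 * (L / 2 * sqnorm2 v)).
pose dphi := fun s : R => dot (grad f (x + s *: v)) v
  - (dot (grad f x) v + 2 * s * (L / 2 * sqnorm2 v)).
have phiD s : is_derive s (1 : R) phi (dphi s).
  apply: is_deriveB; first exact: is_derive_line.
  apply: is_derive_eq.
  by rewrite /= !scaler0 !add0r /GRing.scale/=; ring.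
have [|c c01] := @MVT R phi dphi 0 1 ltr01 (fun s _ => phiD s).
  by apply: derivable_within_continuous => s _; case: (phiD s).
rewrite subr0 mulr1 /phi /dphi scale1r scale0r addr0 => mvt.
have c0 : 0 < c by rewrite (itvP c01).
have := lipschitz_gradient_dot (x + c *: v) x L0 lf.
rewrite [x + c *: v - x]addrC addKr dotZr sqnorm2Z dotDl dotNl => h.
have : dot (grad f (x + c *: v)) v - dot (grad f x) v <= L * c * sqnorm2 v.
  by rewrite -(ler_pM2l c0) (le_trans h)// expr2 !mulrA [L * c]mulrC.
move: mvt; rewrite expr1n expr0n !mul0r !mul1r addr0 !subr0.
exact: aux.
Qed.

Lemma lim_ge_at_right (g h : R -> R) (a b : R) :
  g t @[t --> 0^'+] --> a -> h t @[t --> 0^'+] --> b ->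
  (forall t, 0 < t < 1 -> g t <= h t) -> a <= b.
Proof.
move=> ga hb gh; apply: (ler_cvg_to ga hb).
near=> t; apply: gh; apply/andP; split; near: t.
  exact: nbhs_right_gt.
by apply: nbhs_right_lt; exact: ltr01.
Unshelve. all: by end_near. Qed.

(** A weakly convex function lies above its tangent paraboloids: divide the
    convexity inequality between [x] and [x + v] by the parameter [t] and let
    [t] tend to 0. *)
Lemma weakly_convex_above rho f x v : differentiable f x -> weakly_convex rho f ->
  f x + dot (grad f x) v - rho / 2 * sqnorm2 v <= f (x + v).
Proof.
have aux (t a b c p q w : R) :
    a + rho / 2 * (p + 2 * (t * q) + t ^+ 2 * w)
      <= t * (b + rho / 2 * (p + 2 * q + w)) + (1 - t) * (c + rho / 2 * p) ->
    a <= (1 - t) * c + t * b + rho / 2 * (t * (1 - t)) * w by lra.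
have aux2 (t a b c w : R) :
    a <= (1 - t) * c + t * b + rho / 2 * (t * (1 - t)) * w ->
    a - c <= t * (b - c + rho / 2 * (1 - t) * w) by lra.
have aux3 (a b c w : R) : a <= b - c + rho / 2 * w -> c + a - rho / 2 * w <= b.
  by lra.
move=> df cf.
(* Convexity of [f + rho / 2 * sqnorm2], with the quadratic terms collected. *)
have conv t : 0 < t < 1 ->
    f (x + t *: v)
    <= (1 - t) * f x + t * f (x + v) + rho / 2 * (t * (1 - t)) * sqnorm2 v.
  move=> /andP[t0 t1].
  have ht : Itv.spec (@Itv.num_sem R) (Itv.Real `[0%Z, 1%Z]) t.
    by rewrite /Itv.spec/= /Itv.num_sem/= in_itv/= num_real !ltW.
  have := cf (Itv.mk ht) (x + v) x.
  rewrite !inE => /(_ Logic.I Logic.I); rewrite convRE/=.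
  rewrite [X in f X](_ : _ = x + t *: v); last first.
    by rewrite /conv/= /unstable.onem scalerDr scalerBl scale1r addrC addrA subrK.
  rewrite [X in sqnorm2 X](_ : _ = x + t *: v); last first.
    by rewrite /conv/= /unstable.onem scalerDr scalerBl scale1r addrC addrA subrK.
  rewrite !sqnorm2D dotZr sqnorm2Z /unstable.onem => h; apply: (aux _ _ _ _ _ _ _ h).
pose g t := t^-1 * (f (x + t *: v) - f x).
have gl : g t @[t --> 0^'+] --> dot (grad f x) v.
  have df0 : differentiable f (x + 0 *: v) by rewrite scale0r addr0.
  have [dv vE] := is_derive_line df0.
  rewrite -[X in grad f X](_ : x + 0 *: v = x); last by rewrite scale0r addr0.
  rewrite -vE.
  apply: cvg_dnbhs_at_right.
  rewrite (_ : g = fun h => h^-1 *: (f (x + (h *: 1 + 0) *: v) - f (x + 0 *: v))).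
    exact: dv.
  apply/funext => h; rewrite /g; congr (_ * (f _ - f _));
    last by rewrite scale0r addr0.
  by rewrite addr0 [h *: 1]mulr1.
pose h t := f (x + v) - f x + rho / 2 * (1 - t) * sqnorm2 v.
have hl : h t @[t --> 0^'+] --> f (x + v) - f x + rho / 2 * sqnorm2 v.
  rewrite [X in _ --> X](_ : _ = h 0); last by rewrite /h subr0 mulr1.
  apply: cvg_at_right_filter.
  rewrite /h; apply: cvgD; first exact: cvg_cst.
  apply: cvgM; last exact: cvg_cst.
  apply: cvgM; first exact: cvg_cst.
  by apply: cvgB; [exact: cvg_cst|exact: cvg_id].
have gh : forall t, 0 < t < 1 -> g t <= h t.
  move=> t t01; have := conv _ t01; move: t01 => /andP[t0 t1].
  rewrite /g /h ler_pdivrMl// => hh.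
  exact: aux2 hh.
have := lim_ge_at_right gl hl gh.
exact: aux3.
Qed.

End Smooth.

Section Coercive.
Context {R : realType} {d : nat}.
Implicit Types (f : 'rV[R]_d -> R) (x y v : 'rV[R]_d) (L rho : R).

(** Cocoercivity of the gradient of a smooth weakly convex function, up to a
    defect governed by the weak convexity constant: the classical inequality
    for the convex function [f + rho / 2 * sqnorm2], rewritten in terms of
    [f]. *)
Lemma weakly_cocoercive L rho f x y : 0 < L -> 0 <= rho <= L ->
  lipschitz_gradient L f -> weakly_convex rho f ->
  sqnorm2 (grad f x - grad f y) / (4 * L) - 3 / 2 * rho * sqnorm2 (x - y)
  <= dot (grad f x - grad f y) (x - y).
Proof.
move=> L0 /andP[r0 rL] lf cf.
(* The real arithmetic of the proof: [s] is the step [1 / (2 L)], [p] and [q]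
   are the values of [f] at [x - s *: u] and [y + s *: u], where [u] is the
   gradient difference of [f + rho / 2 * sqnorm2]. *)
have aux (s fx fy p q gxu gyu gxv gyv uu uv vv aa av : R) :
    L * s = 2^-1 -> 0 <= uu -> 0 <= vv ->
    fy + (gyv - s * gyu) - rho / 2 * (vv - 2 * (s * uv) + s ^+ 2 * uu) <= p ->
    p <= fx - s * gxu + L / 2 * (s ^+ 2 * uu) ->
    fx + (s * gxu - gxv) - rho / 2 * (s ^+ 2 * uu - 2 * (s * uv) + vv) <= q ->
    q <= fy + s * gyu + L / 2 * (s ^+ 2 * uu) ->
    gxu - gyu = uu - rho * uv -> gxv - gyv = uv - rho * vv ->
    av = gxv - gyv -> aa <= 2 * uu + 2 * (rho ^+ 2 * vv) ->
    aa / (4 * L) - 3 / 2 * rho * vv <= av.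
  move=> Ls uu0 vv0 h1 h2 h3 h4 e1 e2 -> haa.
  have s0 : 0 < s by rewrite -(pmulr_rgt0 _ L0) Ls invr_gt0.
  have iL : (4 * L)^-1 = s / 2.
    have E : 4 * L * (s / 2) = 1.
      have -> : 4 * L * (s / 2) = 2 * (L * s) by field.
      by rewrite Ls mulfV.
    by rewrite -[LHS]mulr1 -[X in _ * X = _]E mulKf// mulf_neq0// gt_eqF.
  rewrite iL.
  have E : 2 * s * (gxu - gyu)
      <= (gxv - gyv) + rho * (vv - 2 * (s * uv)) + (L + rho) * (s ^+ 2 * uu).
    lra.
  have F : (L + rho) * (s ^+ 2 * uu) <= s * uu.
    have -> : s * uu = (L + L) * (s ^+ 2 * uu).
      have -> : (L + L) * (s ^+ 2 * uu) = 2 * (L * s) * s * uu by ring.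
      by rewrite Ls; field.
    by apply: ler_wpM2r; [rewrite mulr_ge0// sqr_ge0|rewrite lerD2l].
  have G : s * uu <= uv by rewrite e1 e2 in E; lra.
  have H : aa * (s / 2) <= s * uu + s * (rho ^+ 2 * vv).
    have := ler_wpM2r (ltW (divr_gt0 s0 (@ltr0n R 2))) haa; lra.
  have I : s * (rho ^+ 2 * vv) <= rho / 2 * vv.
    have -> : rho / 2 * vv = L * (s * (rho * vv)) by rewrite mulrA Ls; ring.
    have -> : s * (rho ^+ 2 * vv) = rho * (s * (rho * vv)) by ring.
    by apply: ler_wpM2r => //; rewrite !mulr_ge0// ltW.
  rewrite e2; lra.
have df := lf.1.
(* Evaluate [f] at [x - s *: u] and at [y + s *: u], from above by the descent
   lemma and from below by weak convexity at the other point. *)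
set a := grad f x - grad f y; set v := x - y; set u := a + rho *: v.
have gE w : dot (grad f x) w - dot (grad f y) w = dot u w - rho * dot v w.
  by rewrite /u dotDl dotZl addrK /a dotDl dotNl.
set s := (2 * L)^-1.
have Ls : L * s = 2^-1 by rewrite /s invfM mulrCA mulfV ?gt_eqF// mulr1.
have h1 := weakly_convex_above (v - s *: u) (df y) cf.
have h2 := descent_lemma x (- (s *: u)) L0 lf.
have h3 := weakly_convex_above (s *: u - v) (df x) cf.
have h4 := descent_lemma y (s *: u) L0 lf.
have z1 : y + (v - s *: u) = x - s *: u.
  by rewrite /v addrA addrC [y + _]addrC subrK addrC.
have z2 : x + (s *: u - v) = y + s *: u.
  by rewrite /v opprB addrCA addrC [x + _]addrC subrK.
rewrite z1 in h1; rewrite z2 in h3.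
rewrite sqnorm2B dotDr !(dotNr, dotZr) sqnorm2Z in h1.
rewrite sqnorm2N !(dotNr, dotZr) sqnorm2Z in h2.
rewrite sqnorm2B dotDr !(dotNr, dotZr, dotZl) sqnorm2Z in h3.
rewrite !(dotNr, dotZr) sqnorm2Z in h4.
rewrite [dot v u]dotC in h1.

apply: (aux _ _ _ _ _ _ _ _ _ _ _ _ _ _ Ls _ _ h1 h2 h3 h4); rewrite ?sqnorm2_ge0//.
- by rewrite gE dotvv [dot v u]dotC.
- by rewrite gE /u dotDl dotZl addrK.
- have -> : a = u - rho *: v by rewrite /u addrK.
  by apply: le_trans (sqnorm2D_le _ _) _; rewrite sqnorm2N sqnorm2Z.
Qed.

(** Expansion of the square norm of [e - eta *: (a + b)] when [a] is nearly
    cocoercive along [e]: the square norm of [a] is absorbed when [eta] is at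
    most [1 / (4 L)]. *)
Lemma cocoercive_step L rho eta tau (e a b : 'rV[R]_d) : 0 < L ->
  0 < eta -> 4 * L * eta <= 1 -> 0 < tau ->
  sqnorm2 a / (4 * L) - 3 / 2 * rho * sqnorm2 e <= dot a e ->
  sqnorm2 (e - eta *: (a + b))
  <= (1 + 3 * rho * eta + tau^-1) * sqnorm2 e
     + eta ^+ 2 * (tau + 2) * sqnorm2 b.
Proof.
move=> L0 e0 eL t0.
rewrite sqnorm2B sqnorm2Z dotZr dotDr [dot e a]dotC.
have ti : 0 < tau^-1 by rewrite invr_gt0.
have := dot_young (- e) (eta *: b) ti.
rewrite invrK dotNl dotZr sqnorm2N sqnorm2Z.
have := sqnorm2D_le a b.
have := sqnorm2_ge0 a.
move: (sqnorm2 (a + b)) (dot e b) (dot a e) => sab eb ae.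
move: (sqnorm2 a) (sqnorm2 b) (sqnorm2 e) => aa bb ee aa0.
clear -L0 e0 eL aa0 => h1 h2 h3.
have e2 : eta ^+ 2 * sab <= eta ^+ 2 * (2 * aa + 2 * bb) by rewrite ler_wpM2l// sqr_ge0.
have h4 : 2 * eta * (aa / (4 * L)  - 3 / 2 * rho * ee) <= 2 * eta * ae.
  by rewrite ler_wpM2l// mulr_ge0// ltW.
have h5 : eta ^+ 2 * 2 * aa <= 2 * eta * (aa / (4 * L)).
  have -> : 2 * eta * (aa / (4 * L)) = (2 * eta * aa) * (4 * L)^-1 by ring.
  rewrite ler_pdivlMr ?mulr_gt0//.
  have -> : eta ^+ 2 * 2 * aa * (4 * L) = (2 * eta * aa) * (4 * L * eta) by ring.
  by rewrite ler_piMr// !mulr_ge0// ltW.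
lra.
Qed.

End Coercive.

Section Average.
Context {R : realType} {d n : nat}.
Implicit Types (f : 'I_n -> 'rV[R]_d -> R) (x v : 'rV[R]_d) (L : R).

Lemma avg_funE f : avg_fun f = n%:R^-1 *: \sum_(i < n) f i.
Proof. by apply/funext => x; rewrite /avg_fun /GRing.scale/= fct_sumE. Qed.

Lemma differentiable_avg f x : (forall i, differentiable (f i) x) ->
  differentiable (avg_fun f) x.
Proof.
by move=> df; rewrite avg_funE; apply/differentiableZ/differentiable_sum.
Qed.

Lemma grad_avg f x : (forall i, differentiable (f i) x) ->
  grad (avg_fun f) x = n%:R^-1 *: \sum_(i < n) grad (f i) x.
Proof.
move=> df; apply/rowP => j; rewrite gradE mxE summxE.
rewrite -deriveE; last exact: differentiable_avg.
have dv i : derivable (f i) x (delta_mx ord0 j) by exact: diff_derivable.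
rewrite avg_funE deriveZ; last exact: derivable_sum.
by rewrite derive_sum//; congr (_ * _); apply: eq_bigr => i _; rewrite deriveE// gradE.
Qed.

(** The descent lemma passes to averages. *)
Lemma descent_avg L f x v : 0 < L -> (forall i, lipschitz_gradient L (f i)) ->
  (0 < n)%N ->
  avg_fun f (x + v) <= avg_fun f x + dot (grad (avg_fun f) x) v + L / 2 * sqnorm2 v.
Proof.
move=> L0 lf n0; have nr : n%:R != 0 :> R by rewrite pnatr_eq0 -lt0n.
rewrite grad_avg; last by move=> i; case: (lf i).
rewrite /avg_fun dotZl dot_suml.
have -> : L / 2 * sqnorm2 v = n%:R^-1 * \sum_(i < n) (L / 2 * sqnorm2 v).
  by rewrite sumr_const card_ord -[(L / 2 * _) *+ n]mulr_natl mulKf.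
rewrite -!mulrDr -!big_split/= ler_wpM2l ?invr_ge0//.
by apply: ler_sum => i _; exact: descent_lemma.
Qed.

End Average.

(** * One step of the algorithm *)

Section OneStep.
Context {R : realType} {d n : nat}.
Implicit Types X N u : 'I_n -> 'rV[R]_d.
Hypothesis n0 : (0 < n)%N.

(** The average of a finite family of vectors. *)
Definition vavg u : 'rV[R]_d := n%:R^-1 *: \sum_i u i.

Let nr : n%:R != 0 :> R. Proof. by rewrite pnatr_eq0 -lt0n. Qed.

Lemma vavgD_cst u c : vavg (fun i => u i + c) = vavg u + c.
Proof.
rewrite /vavg big_split/= sumr_const card_ord -[c *+ n]scaler_nat scalerDr.
by rewrite scalerA mulVf// scale1r.
Qed.

Lemma vavgB u v : vavg (fun i => u i - v i) = vavg u - vavg v.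
Proof. by rewrite /vavg sumrB scalerBr. Qed.

Lemma avg_sqnorm2_center u :
  n%:R^-1 * \sum_i sqnorm2 (u i - vavg u) <= n%:R^-1 * \sum_i sqnorm2 (u i).
Proof. by rewrite ler_wpM2l ?invr_ge0//; exact: sum_sqnorm2_center. Qed.

(** Convexity of the square norm. *)
Lemma sqnorm2_vavg u : sqnorm2 (vavg u) <= n%:R^-1 * \sum_i sqnorm2 (u i).
Proof.
have h : 0 <= \sum_i sqnorm2 (u i - vavg u).
  by apply: sumr_ge0 => i _; exact: sqnorm2_ge0.
have {h} : 0 <= \sum_i sqnorm2 (u i) - n%:R * sqnorm2 (vavg u).
  apply: le_trans h _; under eq_bigr => i _ do rewrite sqnorm2B.
  rewrite !big_split/= sumr_const card_ord sumrN -mulr_sumr -dot_suml.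
  have -> : \sum_i u i = n%:R *: vavg u by rewrite /vavg scalerA mulfV// scale1r.
  rewrite dotZl dotvv -[sqnorm2 (vavg u) *+ n]mulr_natl.
  by move: (\sum_i sqnorm2 (u i)) (n%:R * _) => a b; lra.
rewrite subr_ge0 => h.
by rewrite ler_pdivlMl// ltr0n.
Qed.

(** In what follows [gf i] stands for the gradient of the [i]-th local function,
    [gF] for the gradient of their average [F], [X] for the workers' iterates
    and [N] for the errors of the stochastic gradients. *)
Context {L rho eta zeta : R} {tau : nat} (F : 'rV[R]_d -> R)
  (gF : 'rV[R]_d -> 'rV[R]_d) (gf : 'I_n -> 'rV[R]_d -> 'rV[R]_d).
Hypotheses (L0 : 0 < L) (r0 : 0 <= rho) (e0 : 0 < eta) (tau2 : (2 <= tau)%N)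
  (eL : 4 * L * eta <= 1) (er : 4 * rho * eta * tau%:R <= 1).
Hypothesis gFE : forall y, gF y = vavg (gf^~ y).
Hypothesis gf_lip : forall i y z,
  sqnorm2 (gf i y - gf i z) <= L ^+ 2 * sqnorm2 (y - z).
Hypothesis gf_coco : forall i y z,
  sqnorm2 (gf i y - gf i z) / (4 * L) - 3 / 2 * rho * sqnorm2 (y - z)
  <= dot (gf i y - gf i z) (y - z).
Hypothesis gf_sim : forall y,
  n%:R^-1 * \sum_i sqnorm2 (gf i y - gF y) <= zeta ^+ 2.
Hypothesis F_desc : forall y v,
  F (y + v) <= F y + dot (gF y) v + L / 2 * sqnorm2 v.

(** The position of worker [i] after a noiseless step, relative to the step of
    the mean along [gF]. *)
Definition drift X (i : 'I_n) : 'rV[R]_d :=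
  (X i - vavg X) - eta *: (gf i (X i) - gF (vavg X)).

Lemma sqnorm2_drift X i :
  sqnorm2 (drift X i) <= (1 + 2 / tau%:R) * sqnorm2 (X i - vavg X)
    + eta ^+ 2 * (2 * tau%:R) * sqnorm2 (gf i (vavg X) - gF (vavg X)).
Proof.
have t2 : 2 <= tau%:R :> R by rewrite ler_nat.
have t0 : 0 < tau%:R :> R by exact: lt_le_trans t2.
rewrite /drift.
rewrite -(subrKA (gf i (vavg X)) (gf i (X i)) (- gF (vavg X))).
apply: le_trans (cocoercive_step (gf i (vavg X) - gF (vavg X))
  L0 e0 eL t0 (gf_coco i _ _)) _.
apply: lerD.
  apply: ler_wpM2r; first exact: sqnorm2_ge0.
  have -> : 2 / tau%:R = tau%:R^-1 + tau%:R^-1 :> R by field; rewrite gt_eqF.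
  have : 3 * rho * eta <= tau%:R^-1.
    rewrite -[leRHS]mul1r ler_pdivlMr//; apply: le_trans er.
    have : 0 <= rho * eta * tau%:R by rewrite !mulr_ge0// ltW.
    lra.
  lra.
apply: ler_wpM2r; first exact: sqnorm2_ge0.
apply: ler_wpM2l; first exact: sqr_ge0.
lra.
Qed.

(** One noisy local step spreads the workers by a controlled amount. *)
Lemma consensus_step X N (X' := fun i => X i - eta *: (gf i (X i) + N i)) :
  n%:R^-1 * \sum_i sqnorm2 (X' i - vavg X')
  <= (1 + 2 / tau%:R) * (n%:R^-1 * \sum_i sqnorm2 (X i - vavg X))
     + eta ^+ 2 * (2 * tau%:R) * zeta ^+ 2
     - 2 * eta * (n%:R^-1 * \sum_i dot (drift X i) (N i))
     + eta ^+ 2 * (n%:R^-1 * \sum_i sqnorm2 (N i)).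
Proof.
(* [c] is the fictitious noiseless step of the mean along [gF]. *)
pose c := vavg X - eta *: gF (vavg X).
pose u i := drift X i - eta *: N i.
have X'E : X' = (fun i => u i + c).
  apply/funext => i; rewrite /X' /u /drift /c scalerDr scalerBr opprD opprB.
  set a := eta *: gf i (X i); set b := eta *: N i; set e := eta *: gF _.
  apply/rowP => j; rewrite !mxE; ring.
rewrite X'E vavgD_cst.
under eq_bigr => i _ do rewrite opprD addrACA subrr addr0.
apply: le_trans (avg_sqnorm2_center u) _.
have hu i : sqnorm2 (u i) <= (1 + 2 / tau%:R) * sqnorm2 (X i - vavg X)
    + eta ^+ 2 * (2 * tau%:R) * sqnorm2 (gf i (vavg X) - gF (vavg X))
    - 2 * eta * dot (drift X i) (N i) + eta ^+ 2 * sqnorm2 (N i).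
  rewrite /u [sqnorm2 (drift X i - _)]sqnorm2B [sqnorm2 (eta *: N i)]sqnorm2Z.
  rewrite [dot _ (eta *: N i)]dotZr [2 * (eta * _)]mulrA 2!lerD2r.
  exact: sqnorm2_drift.
have ni : 0 <= n%:R^-1 :> R by rewrite invr_ge0.
apply: le_trans (ler_wpM2l ni (ler_sum _ (fun i _ => hu i))) _.
rewrite !big_split/= sumrN -!mulr_sumr.
have aux (k p q r s A B C E : R) : 0 <= q -> k * B <= zeta ^+ 2 ->
    k * (p * A + q * B - r * C + s * E)
    <= p * (k * A) + q * zeta ^+ 2 - r * (k * C) + s * (k * E).
  by move=> q0 /(ler_wpM2l q0); lra.
apply: aux; last exact: gf_sim.
by rewrite mulr_ge0// sqr_ge0.
Qed.

(** One step of the mean decreases [F], up to the spread of the workers and to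
    the noise. *)
Lemma descent_step X N (m := vavg (fun i => gf i (X i))) (nu := vavg N) :
  F (vavg X - eta *: (m + nu))
  <= F (vavg X) - eta / 2 * sqnorm2 (gF (vavg X))
     + eta * L ^+ 2 / 2 * (n%:R^-1 * \sum_i sqnorm2 (X i - vavg X))
     + dot ((L * eta ^+ 2) *: m - eta *: gF (vavg X)) nu
     + L * eta ^+ 2 / 2 * sqnorm2 nu.
Proof.
(* The real arithmetic of the proof: [gg], [mm], [vv] are the square norms of
   [gF (vavg X)], [m], [nu], and [gm], [gn], [mn] their inner products. *)
have aux (a gg mm gm gn mn vv D f : R) :
    0 <= mm -> gg - 2 * gm + mm <= L ^+ 2 * D ->
    f <= a + - (eta * (gm + gn)) + L / 2 * (eta ^+ 2 * (mm + 2 * mn + vv)) ->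
    f <= a - eta / 2 * gg + eta * L ^+ 2 / 2 * D
       + (L * eta ^+ 2 * mn - eta * gn) + L * eta ^+ 2 / 2 * vv.
  move=> mm0 hD hf; apply: le_trans hf _.
  have h1 : eta / 2 * (gg - 2 * gm + mm) <= eta / 2 * (L ^+ 2 * D).
    by rewrite ler_wpM2l// divr_ge0// ltW.
  have h2 : L * eta * (eta * mm) <= 1 * (eta * mm).
    apply: ler_wpM2r; first by rewrite mulr_ge0// ltW.
    have : 0 <= L * eta by rewrite mulr_ge0// ltW.
    by move: eL; rewrite -mulrA; move: (L * eta) => le; lra.
  lra.
have hD : sqnorm2 (gF (vavg X) - m)
    <= L ^+ 2 * (n%:R^-1 * \sum_i sqnorm2 (X i - vavg X)).
  rewrite gFE /m -vavgB; apply: le_trans (sqnorm2_vavg _) _.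
  rewrite mulrCA ler_wpM2l ?invr_ge0// mulr_sumr.
  by apply: ler_sum => i _; rewrite -sqnorm2N opprB; exact: gf_lip.
rewrite sqnorm2B in hD.
have := F_desc (vavg X) (- (eta *: (m + nu))).
rewrite sqnorm2N sqnorm2Z dotNr dotZr dotDr sqnorm2D => hf.
rewrite dotDl dotNl [dot (_ *: m) nu]dotZl [dot (eta *: _) nu]dotZl.
exact: aux (sqnorm2_ge0 m) hD hf.
Qed.

End OneStep.

(** * Borel measurability of vectors *)

Section Borel.
Context {R : realType} {d : nat}.

Lemma bigcup_count_measurable (dT : measure_display) (T : measurableType dT)
    (I : countType) (F : I -> set T) :
  (forall i, measurable (F i)) -> measurable (\bigcup_i F i).
Proof.
move=> mF.
rewrite (_ : \bigcup_i F i = \bigcup_k (if unpickle k is Some i then F i else set0)).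
  by apply: bigcupT_measurable => k; case: unpickle.
apply/seteqP; split => x [].
  by move=> i _ Fx; exists (pickle i) => //; rewrite pickleK.
by move=> k _; case: unpickle => // i Fx; exists i.
Qed.

Lemma continuous_borel_measurable (f : 'rV[R]_d -> R) : continuous f ->
  measurable_fun [set: borel_rV R d] (f : borel_rV R d -> R).
Proof.
move=> cf; apply: (measurability (@RGenOpens.G R)).
  exact: RGenOpens.measurableE.
move=> _ [_ [a [b ->]] <-]; rewrite setTI.
apply: sub_sigma_algebra => /=.
by move/continuousP: cf; apply; exact: interval_open.
Qed.

(** The open boxes with rational centre and radius [1 / k] form a base of the
    topology, so that Borel measurability is tested coordinatewise. *)
Lemma measurable_rVP (dT : measure_display) (T : measurableType dT)
    (X : T -> 'rV[R]_d) :
  measurable_fun [set: T] (X : T -> borel_rV R d) <->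
  forall j, measurable_fun [set: T] (fun w => X w ord0 j).
Proof.
split=> [mX j|mX].
  have cj : continuous (fun v : 'rV[R]_d => v ord0 j) by exact: coord_continuous.
  exact: (measurableT_comp (continuous_borel_measurable cj) mX).
apply: measurability; first by [].
move=> _ [U /= oU <-]; rewrite setTI.
pose box (p : 'rV[rat]_d * nat) : set 'rV[R]_d :=
  [set y | forall j, `|ratr (p.1 ord0 j) - y ord0 j| < p.2.+1%:R^-1].
pose F (p : 'rV[rat]_d * nat) := if `[< box p `<=` U >] then X @^-1` box p else set0.
rewrite (_ : X @^-1` U = \bigcup_p F p).
  apply: bigcup_count_measurable => p; rewrite /F; case: asboolP => // _.
  rewrite (_ : X @^-1` box p = \bigcap_(j in [set: 'I_d])
      ((fun w => X w ord0 j) @^-1` [set y | `|ratr (p.1 ord0 j) - y| < p.2.+1%:R^-1])).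
    apply: fin_bigcap_measurable => // j _.
    rewrite -[X in measurable X]setTI; apply: mX => //.
    apply: open_measurable.
    exact: (@ball_open _ R^o).
  by apply/seteqP; split => [w Xw j _|w Xw j]; [exact: Xw|exact: (Xw j)].
apply/seteqP; split => [w UXw|w [p _]]; last first.
  by rewrite /F; case: asboolP => // pU /pU.
have /nbhs_ballP[e /= e0 eU] : nbhs (X w) U by move: oU; rewrite openE; exact.
have [k _ ke] : exists2 k, True & k.+1%:R^-1 < e / 2.
  have [k ke] := @ltr_add_invr R 0 (e / 2) (divr_gt0 e0 (ltr0n _ 2)).
  by exists k => //; rewrite add0r in ke.
have ex j : exists q : rat, `|ratr q - X w ord0 j| < k.+1%:R^-1.
  have [|r [/= Br [q _ qr]]] :=
      @dense_rat R (ball (X w ord0 j) (k.+1%:R^-1)) _ (@ball_open _ R^o _ _).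
    by exists (X w ord0 j); apply: ballxx; rewrite invr_gt0.
  by exists q; rewrite qr distrC.
have [q hq] := choice ex.
exists (\row_j q j, k) => //; rewrite /F; case: asboolP => /= [_ j|].
  by rewrite mxE.
case => y hy; apply: eU; split => // i j; rewrite (ord1 i) /ball/=.
have := hy j; rewrite /= mxE => h1; have h2 := hq j.
rewrite (_ : X w ord0 j - _
  = (ratr (q j) - y ord0 j) - (ratr (q j) - X w ord0 j)); last by ring.
apply: le_lt_trans (ler_normB _ _) _.
by rewrite [e]splitr ltrD// (lt_trans _ ke).
Qed.

End Borel.

(** * Independence *)

Section IndependentPair.
Context {R : realType} {dO d1 d2 : measure_display} {Omega : measurableType dO}
  {T1 : measurableType d1} {T2 : measurableType d2} (P : probability Omega R)
  (U : Omega -> T1) (V : Omega -> T2).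
Hypothesis mU : measurable_fun [set: Omega] U.
Hypothesis mV : measurable_fun [set: Omega] V.
Hypothesis indUV : forall A B, measurable A -> measurable B ->
  (P (U @^-1` A `&` V @^-1` B) = P (U @^-1` A) * P (V @^-1` B))%E.

Let U' : {mfun Omega >-> T1} := HB.pack U (isMeasurableFun.Build _ _ _ _ U mU).
Let V' : {mfun Omega >-> T2} := HB.pack V (isMeasurableFun.Build _ _ _ _ V mV).
Let mUV : measurable_fun [set: Omega] (fun w => (U w, V w)).
Proof. by apply/measurable_fun_pairP; split. Qed.
Let UV : {mfun Omega >-> (T1 * T2)%type} :=
  HB.pack (fun w => (U w, V w)) (isMeasurableFun.Build _ _ _ _ _ mUV).

Let joint_law (A : set (T1 * T2)) : measurable A ->
  (distribution P U' \x distribution P V')%E A = distribution P UV A.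
Proof.
move=> mA; by apply: product_measure_unique => // B C mB mC; exact: indUV.
Qed.

(** Tonelli's theorem for independent random variables. *)
Lemma ge0_integral_indep (h : T1 * T2 -> \bar R) :
  measurable_fun [set: T1 * T2] h -> (forall z, 0 <= h z)%E ->
  (\int[P]_w h (U w, V w) = \int[P]_w \int[P]_w' h (U w, V w'))%E.
Proof.
move=> mh h0.
transitivity (\int[distribution P UV]_z h z)%E; first by rewrite ge0_integral_distribution.
rewrite (eq_measure_integral (distribution P U' \x distribution P V')%E); last first.
  by move=> A mA _; exact/esym/joint_law.
rewrite fubini_tonelli1// ge0_integral_distribution//.
- apply: eq_integral => w _; rewrite /fubini_F/=.
  rewrite ge0_integral_distribution//.
  exact: measurableT_comp.
- exact: measurable_fun_fubini_tonelli_F.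
- by move=> x; exact: integral_ge0.
Qed.

Lemma measurable_integral_section (h : T1 * T2 -> \bar R) :
  measurable_fun [set: T1 * T2] h -> (forall z, 0 <= h z)%E ->
  measurable_fun [set: Omega] (fun w => \int[P]_w' h (U w, V w'))%E.
Proof.
move=> mh h0.
rewrite (_ : (fun w => _) = fubini_F (distribution P V') h \o U).
  by apply: measurableT_comp => //; exact: measurable_fun_fubini_tonelli_F.
apply/funext => w; rewrite /fubini_F/= ge0_integral_distribution//.
exact: measurableT_comp.
Qed.

(** Fubini's theorem for independent random variables, when the inner integral
    vanishes. *)
Lemma integral_indep_eq0 (h : T1 * T2 -> \bar R) :
  measurable_fun [set: T1 * T2] h ->
  P.-integrable [set: Omega] (fun w => h (U w, V w)) ->
  (forall x, P.-integrable [set: Omega] (fun w => h (x, V w))) ->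
  (forall x, \int[P]_w h (x, V w) = 0)%E ->
  (\int[P]_w h (U w, V w) = 0)%E.
Proof.
move=> mh ih ihx hx.
transitivity (\int[distribution P UV]_z h z)%E; first by rewrite integral_distribution.
rewrite (eq_measure_integral (distribution P U' \x distribution P V')%E); last first.
  by move=> A mA _; exact/esym/joint_law.
rewrite -integral12_prod_meas1.
  apply: integral0_eq => x _; rewrite /fubini_F integral_distribution//.
  - exact: hx.
  - exact: measurableT_comp.
  - exact: ihx.
apply/integrableP; split => //.
rewrite (eq_measure_integral (distribution P UV)); last first.
  by move=> A mA _; exact: joint_law.
rewrite ge0_integral_distribution//; last exact: measurableT_comp.
by have /integrableP[] := ih.
Qed.

End IndependentPair.

Section Others.
Context {R : realType} {dO dX : measure_display} {Omega : measurableType dO}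
  (P : probability Omega R) {I : finType} {Xi : I -> measurableType dX}
  (X : forall k, Omega -> Xi k).
Hypothesis mX : forall k, measurable_fun [set: Omega] (X k).

(** Cylinder events that do not constrain the variable of index [k0]; they are
    stable by intersection and generate the sigma algebra of all the variables
    but that one. *)
Definition others (k0 : I) : set (set Omega) :=
  [set A | exists B : forall k, set (Xi k), [/\ forall k, measurable (B k),
     B k0 = setT & A = \bigcap_k X k @^-1` B k]].

Lemma others_measurable k0 : <<s others k0 >> `<=` @measurable _ Omega.
Proof.
apply: smallest_sub; first exact: sigma_algebra_measurable.
move=> _ [B [mB _ ->]]; apply: fin_bigcap_measurable => // k _.
by rewrite -[X in measurable X]setTI; exact: (mX measurableT (mB k)).
Qed.

Lemma measurable_others k0 k : k != k0 ->
  measurable_fun [set: g_sigma_algebraType (others k0)]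
    (X k : g_sigma_algebraType (others k0) -> Xi k).
Proof.
move=> kk0 _ A mA; rewrite setTI; apply: sub_sigma_algebra.
exists (@eqtype.dfwith I (fun k => set (Xi k)) (fun k => setT) k A); split.
- by move=> j; case: eqtype.dfwithP.
- by rewrite eqtype.dfwith_out.
- apply/seteqP; split => [w Aw j _|w /(_ k Logic.I)]; last first.
    by rewrite /preimage/= eqtype.dfwith_in.
  by rewrite /preimage/=; case: eqtype.dfwithP.
Qed.

(** In a mutually independent family, each variable is independent of the sigma
    algebra generated by all the others: two finite measures that agree on the
    cylinders agree on what these generate. *)
Lemma others_indep k0 (A : set Omega) (B : set (Xi k0)) :
  mutually_independent P X -> <<s others k0 >> A -> measurable B ->
  (P (A `&` X k0 @^-1` B) = P A * P (X k0 @^-1` B))%E.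
Proof.
move=> ind sA mB.
have mXB : measurable (X k0 @^-1` B).
  by rewrite -[X in measurable X]setTI; exact: (mX measurableT mB).
have p0 : (0 <= fine (P (X k0 @^-1` B)))%R by rewrite fine_ge0.
have pE : (fine (P (X k0 @^-1` B)))%:E = P (X k0 @^-1` B).
  by rewrite fineK// fin_num_measure.
rewrite muleC -pE.
apply: (@g_sigma_algebra_measure_unique _ _ _ (others k0) _ (fun _ => setT) _ _
  (mrestr P mXB) (mscale (NngNum p0) P)) => //.
- by move=> C oC; apply: others_measurable; exact: sub_sigma_algebra oC.
- move=> _; exists (fun k => setT); split => //.
  by apply/seteqP; split.
- by rewrite bigcup_const//; exists 0%N.
- move=> _ _ [B1 [mB1 B1T ->]] [B2 [mB2 B2T ->]].
  exists (fun k => B1 k `&` B2 k); split.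
  + by move=> k; exact: measurableI.
  + by rewrite B1T B2T setTI.
  + by rewrite -bigcapI.
- move=> _ [C [mC CT ->]]; 
  suff : (P ((\bigcap_k X k @^-1` C k) `&` X k0 @^-1` B)
      = P (X k0 @^-1` B) * P (\bigcap_k X k @^-1` C k))%E.
    by move=> e; apply: (etrans e); rewrite -[X in (X * _)%E = _]pE.
  have inJ (D : forall k, set (Xi k)) : \bigcap_k X k @^-1` D k =
      \bigcap_(k in [set` finset.setTfor I]) X k @^-1` D k.
    by congr bigcap; apply/seteqP; split => k //= _; rewrite inE.
  (* [C'] adds the constraint [B] on the variable [k0] to the cylinder [C]. *)
  pose C' := @eqtype.dfwith I (fun k => set (Xi k)) C k0 B.
  have mC' k : measurable (C' k) by rewrite /C'; case: eqtype.dfwithP.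
  have -> : P ((\bigcap_k X k @^-1` C k) `&` X k0 @^-1` B) = P (\bigcap_k X k @^-1` C' k).
    congr (P _); apply/seteqP; split => [w [Cw Bw] k _|w Cw]; rewrite /preimage/=.
      by rewrite /C'; case: eqtype.dfwithP => // j _; exact: Cw.
    split; last by have := Cw k0 Logic.I; rewrite /C' /preimage/= eqtype.dfwith_in.
    move=> k _; have := Cw k Logic.I; rewrite /C' /preimage/=.
    by case: eqtype.dfwithP => //; rewrite CT.
  rewrite !inJ !(ind (finset.setTfor I))// (bigD1 k0) ?inE//= [in RHS](bigD1 k0) ?inE//=.
  rewrite CT preimage_setT probability_setT mul1e /C' eqtype.dfwith_in.
  congr (_ * _)%E; apply: eq_bigr => k /andP[_ kk0].
  by rewrite eqtype.dfwith_out// eq_sym.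
- move=> _; apply: (@le_lt_trans _ _ (1%E : \bar R)); last by rewrite ltry.
  by apply: (@probability_le1 _ _ _ P); rewrite setTI.
Qed.

End Others.

(** * Random variables with finite moments *)

Section Integrability.
Context {R : realType} {dO : measure_display} {Omega : measurableType dO}
  (P : probability Omega R).
Implicit Types X Y : Omega -> R.

(** Real random variables with a finite mean. *)
Definition L1 X : Prop := P.-integrable [set: Omega] (EFin \o X).

(** Real random variables with a finite second moment. *)
Definition L2 X : Prop :=
  measurable_fun [set: Omega] X /\ L1 (fun w => X w ^+ 2).

(** The mean as a real number; meaningful on [L1]. *)
Definition mean X : R := \int[P]_w X w.

Lemma L1D X Y : L1 X -> L1 Y -> L1 (fun w => X w + Y w).
Proof. by move=> hX hY; have := integrableD measurableT hX hY. Qed.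

Lemma L1Z a X : L1 X -> L1 (fun w => a * X w).
Proof. by move=> hX; have := integrableZl measurableT a hX. Qed.

Lemma L1N X : L1 X -> L1 (fun w => - X w).
Proof.
by move=> /(L1Z (-1)); congr L1; apply/funext => w; rewrite mulN1r.
Qed.

Lemma L1B X Y : L1 X -> L1 Y -> L1 (fun w => X w - Y w).
Proof. by move=> hX /L1N; exact: L1D. Qed.

Lemma L1_cst a : L1 (fun=> a).
Proof. exact: finite_measure_integrable_cst. Qed.

Lemma L1_sum (I : Type) (s : seq I) (X : I -> Omega -> R) :
  (forall i, L1 (X i)) -> L1 (fun w => \sum_(i <- s) X i w).
Proof.
move=> hX; elim: s => [|i s IH].
  by under [X in L1 X]funext => w do rewrite big_nil; exact: L1_cst.
by under [X in L1 X]funext => w do rewrite big_cons; exact: L1D.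
Qed.

Lemma L1_le X Y : measurable_fun [set: Omega] X -> (forall w, `|X w| <= Y w) ->
  L1 Y -> L1 X.
Proof.
move=> mX XY; apply: le_integrable => //; first exact/measurable_EFinP.
by move=> w _ /=; rewrite lee_fin (le_trans (XY w))// ler_norm.
Qed.

Lemma expectation_mean X : L1 X -> ('E_P[X] = (mean X)%:E)%E.
Proof.
by move=> hX; rewrite unlock /mean /Rintegral fineK// integrable_fin_num.
Qed.

Lemma meanD X Y : L1 X -> L1 Y -> mean (fun w => X w + Y w) = mean X + mean Y.
Proof. by move=> hX hY; rewrite /mean RintegralD. Qed.

Lemma meanZ a X : L1 X -> mean (fun w => a * X w) = a * mean X.
Proof. by move=> hX; rewrite /mean RintegralZl. Qed.

Lemma mean_cst a : mean (fun=> a) = a.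
Proof.
rewrite /mean Rintegral_cst// -[RHS]mulr1; congr (_ * _).
exact: (congr1 fine (probability_setT P)).
Qed.

Lemma mean_le X Y : L1 X -> L1 Y -> (forall w, X w <= Y w) -> mean X <= mean Y.
Proof. by move=> hX hY XY; rewrite /mean le_Rintegral. Qed.

Lemma mean_ge0 X : (forall w, 0 <= X w) -> 0 <= mean X.
Proof. by move=> X0; rewrite /mean Rintegral_ge0. Qed.

Lemma mean_sum (I : Type) (s : seq I) (X : I -> Omega -> R) :
  (forall i, L1 (X i)) -> mean (fun w => \sum_(i <- s) X i w) = \sum_(i <- s) mean (X i).
Proof.
move=> hX; elim: s => [|i s IH].
  by under [X in mean X]funext => w do rewrite big_nil; rewrite big_nil mean_cst.
under [X in mean X]funext => w do rewrite big_cons.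
by rewrite big_cons -IH meanD//; exact: L1_sum.
Qed.

Lemma L2_le X Y : measurable_fun [set: Omega] X ->
  (forall w, X w ^+ 2 <= Y w) -> L1 Y -> L2 X.
Proof.
move=> mX XY hY; split => //; apply: L1_le hY; first exact: measurable_funX.
by move=> w; rewrite ger0_norm// sqr_ge0.
Qed.

Lemma L2D X Y : L2 X -> L2 Y -> L2 (fun w => X w + Y w).
Proof.
move=> [mX hX] [mY hY]; apply: L2_le (L1D (L1Z 2 hX) (L1Z 2 hY)).
  exact: measurable_funD.
move=> w; have := sqr_ge0 (X w - Y w); move: (X w) (Y w) => a b; lra.
Qed.

Lemma L2Z a X : L2 X -> L2 (fun w => a * X w).
Proof.
move=> [mX hX]; apply: L2_le (L1Z (a ^+ 2) hX); first exact: measurable_funM.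
by move=> w; rewrite exprMn.
Qed.

Lemma L2_cst a : L2 (fun=> a).
Proof. by split => //; exact: L1_cst. Qed.

Lemma L2M X Y : L2 X -> L2 Y -> L1 (fun w => X w * Y w).
Proof.
move=> [mX hX] [mY hY]; apply: L1_le (L1D hX hY); first exact: measurable_funM.
move=> w; move: (X w) (Y w) => a b; rewrite ler_norml.
by have := sqr_ge0 (a - b); have := sqr_ge0 (a + b); nra.
Qed.

Context {d : nat}.
Implicit Types u v : Omega -> 'rV[R]_d.

(** Random vectors whose coordinates have finite second moments. *)
Definition vL2 u : Prop := forall j, L2 (fun w => u w ord0 j).

Lemma vL2D u v : vL2 u -> vL2 v -> vL2 (fun w => u w + v w).
Proof.
by move=> hu hv j; under [X in L2 X]funext => w do rewrite mxE; exact: L2D.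
Qed.

Lemma vL2Z a u : vL2 u -> vL2 (fun w => a *: u w).
Proof.
by move=> hu j; under [X in L2 X]funext => w do rewrite mxE; exact: L2Z.
Qed.

Lemma vL2B u v : vL2 u -> vL2 v -> vL2 (fun w => u w - v w).
Proof.
move=> hu /(vL2Z (-1)) hv.
by under [X in vL2 X]funext => w do rewrite -scaleN1r; exact: vL2D.
Qed.

Lemma vL2_cst a : vL2 (fun=> a).
Proof. by move=> j; exact: L2_cst. Qed.

Lemma vL2_sum (I : Type) (s : seq I) (u : I -> Omega -> 'rV[R]_d) :
  (forall i, vL2 (u i)) -> vL2 (fun w => \sum_(i <- s) u i w).
Proof.
move=> hu; elim: s => [|i s IH].
  by under [X in vL2 X]funext => w do rewrite big_nil; exact: vL2_cst.
by under [X in vL2 X]funext => w do rewrite big_cons; exact: vL2D.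
Qed.

Lemma vL2_dot u v : vL2 u -> vL2 v -> L1 (fun w => dot (u w) (v w)).
Proof. by move=> hu hv; apply: L1_sum => j; exact: L2M. Qed.

Lemma vL2_sqnorm2 u : vL2 u -> L1 (fun w => sqnorm2 (u w)).
Proof. by move=> hu; apply: L1_sum => j; have [] := hu j. Qed.

Lemma vL2_measurable u : vL2 u ->
  measurable_fun [set: Omega] (u : Omega -> borel_rV R d).
Proof. by move=> hu; apply/measurable_rVP => j; have [] := hu j. Qed.

Lemma vL2_le u X : measurable_fun [set: Omega] (u : Omega -> borel_rV R d) ->
  (forall w, sqnorm2 (u w) <= X w) -> L1 X -> vL2 u.
Proof.
move=> /measurable_rVP mu uX hX j; apply: L2_le hX => // w.
exact: le_trans (sqr_coord_le _ _) _.
Qed.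

End Integrability.

(** * Fresh noise *)

Section Noise.
Context {R : realType} {dO dX : measure_display} {Omega : measurableType dO}
  (P : probability Omega R) {Xi : measurableType dX} (V : Omega -> Xi)
  (H : set (set Omega)).
Hypothesis mV : measurable_fun [set: Omega] V.
Hypothesis subH : <<s H >> `<=` @measurable _ Omega.
Hypothesis indV : forall A B, <<s H >> A -> measurable B ->
  (P (A `&` V @^-1` B) = P A * P (V @^-1` B))%E.

(* The outcomes with the events of [H], on which the point [x] depends and of
   which the sample [V] is independent. *)
Local Notation past := (g_sigma_algebraType H).

Lemma measurable_past (dT : measure_display) (T : measurableType dT) (Y : Omega -> T) :
  measurable_fun [set: past] (Y : past -> T) -> measurable_fun [set: Omega] Y.
Proof.
move=> mY _ A mA; rewrite setTI; apply: subH.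
by have := mY measurableT A mA; rewrite setTI.
Qed.

Let mid : measurable_fun [set: Omega] (idfun : Omega -> past).
Proof. exact/measurable_past/measurable_id. Qed.

Context {d : nat} (x : Omega -> 'rV[R]_d) (G : 'rV[R]_d -> Xi -> 'rV[R]_d)
  (gf : 'rV[R]_d -> 'rV[R]_d) (sigma : R).
Hypothesis mx : measurable_fun [set: past] (x : past -> borel_rV R d).
Hypothesis mG : measurable_fun [set: borel_rV R d * Xi]
  (fun p : borel_rV R d * Xi => G p.1 p.2 : borel_rV R d).
Hypothesis mgf : measurable_fun [set: borel_rV R d] (gf : borel_rV R d -> borel_rV R d).
Hypothesis meanG : forall y, has_mean P (fun w => G y (V w)) (gf y).
Hypothesis varG : forall y,
  ('E_P[fun w => sqnorm2 (G y (V w) - gf y)] <= (sigma ^+ 2)%:E)%E.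

Let noise w := G (x w) (V w) - gf (x w).

Let joint_noise (z : past * Xi) : 'rV[R]_d := G (x z.1) z.2 - gf (x z.1).

Let mjoint j : measurable_fun [set: past * Xi] (fun z => joint_noise z ord0 j).
Proof.
under [X in measurable_fun _ X]funext => z do rewrite !mxE.
have m1 : measurable_fun [set: past * Xi] (fun z : past * Xi => (x z.1 : borel_rV R d)).
  exact: (measurableT_comp mx).
apply: measurable_funB.
  have m2 : measurable_fun [set: past * Xi]
      (fun z : past * Xi => ((x z.1 : borel_rV R d), z.2)).
    by apply/measurable_fun_pairP; split; [exact: m1|exact: measurable_snd].
  have m3 := measurableT_comp mG m2.
  by have /measurable_rVP := m3; apply.
have m3 := measurableT_comp mgf m1.
by have /measurable_rVP := m3; apply.
Qed.

Let noise_measurable : measurable_fun [set: Omega] (noise : Omega -> borel_rV R d).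
Proof.
apply/measurable_rVP => j.
have m1 : measurable_fun [set: Omega] (fun w => ((w : past), V w)).
  by apply/measurable_fun_pairP; split; [exact: mid|exact: mV].
exact: (measurableT_comp (mjoint j) m1).
Qed.

Let sq_noise_int :
  (\int[P]_w (sqnorm2 (noise w))%:E <= (sigma ^+ 2)%:E)%E.
Proof.
pose h (z : past * Xi) := (sqnorm2 (joint_noise z))%:E.
have mh : measurable_fun [set: past * Xi] h.
  by apply/measurable_EFinP; apply: measurable_sum => j; exact: measurable_funX.
have h0 z : (0 <= h z)%E by rewrite lee_fin sqnorm2_ge0.
have -> := ge0_integral_indep mid mV indV mh h0.
apply: (@le_trans _ _ (\int[P]_w (cst (sigma ^+ 2)%:E w))%E).
  apply: ge0_le_integral => //.
  - by move=> w _; exact: integral_ge0.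
  - exact: (measurable_integral_section P mid mV).
  - move=> w _; have := varG (x w); by rewrite unlock.
rewrite integral_cst// [X in (_ * X)%E](_ : _ = 1%E) ?mule1//.
exact: probability_setT.
Qed.

(** Although the oracle only bounds the variance at fixed points, the noise at
    the random point [x] has a finite second moment. *)
Lemma noise_vL2 : vL2 P noise.
Proof.
apply: vL2_le noise_measurable (fun w => lexx _) _.
apply/integrableP; split.
  apply/measurable_EFinP; apply: measurable_sum => j; apply: measurable_funX.
  by have /measurable_rVP := noise_measurable; apply.
apply: le_lt_trans (ltry (sigma ^+ 2)); apply: le_trans sq_noise_int.
by under eq_integral => w _ do rewrite /= ger0_norm ?sqnorm2_ge0//.
Qed.

Lemma mean_sqnorm2_noise : mean P (fun w => sqnorm2 (noise w)) <= sigma ^+ 2.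
Proof.
rewrite -lee_fin -expectation_mean; last exact/vL2_sqnorm2/noise_vL2.
by rewrite unlock; exact: sq_noise_int.
Qed.

(** The noise is orthogonal to whatever belongs to the past. *)
Lemma mean_dot_noise (Y : Omega -> 'rV[R]_d) :
  measurable_fun [set: past] (Y : past -> borel_rV R d) -> vL2 P Y ->
  mean P (fun w => dot (Y w) (noise w)) = 0.
Proof.
move=> mY Y2; rewrite /dot mean_sum; last by move=> j; apply: L2M => //; exact: noise_vL2.
apply: big1 => j _; rewrite /mean /Rintegral.
pose h (z : past * Xi) := (Y z.1 ord0 j * joint_noise z ord0 j)%:E.
have mh : measurable_fun [set: past * Xi] h.
  apply/measurable_EFinP; apply: measurable_funM => //.
  have m1 : measurable_fun [set: past * Xi] (fun z : past * Xi => (Y z.1 : borel_rV R d)).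
    exact: (measurableT_comp mY).
  by have /measurable_rVP := m1; apply.
have cE w v : h (w, v) = (Y w ord0 j * (G (x w) v ord0 j - gf (x w) ord0 j))%:E.
  by rewrite /h /joint_noise /= !mxE.
have L1w w : L1 P (fun w' => G (x w) (V w') ord0 j - gf (x w) ord0 j).
  by apply: L1B; [have [] := meanG (x w) j|exact: L1_cst].
rewrite (_ : (\int[P]_w _)%E = 0%E)//.
apply: (integral_indep_eq0 mid mV indV mh).
- have := L2M (Y2 j) (noise_vL2 j).
  by [].
- by move=> w; under eq_fun => w' do rewrite cE; exact: (L1Z _ (L1w w)).
- move=> w; under eq_integral => w' _ do rewrite cE.
  have := expectation_mean (L1Z (Y w ord0 j) (L1w w)); rewrite unlock => ->.
  rewrite meanZ// meanD ?mean_cst; [|by have [] := meanG (x w) j|exact: L1_cst].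
  have [i1 e1] := meanG (x w) j.
  have := expectation_mean i1; rewrite e1 => -[<-].
  by rewrite subrr mulr0.
Qed.

End Noise.

(** * The dynamics of LocalSGD *)

Section BorelVector.
Context {R : realType} {d : nat}.

Lemma sqnorm2_ball (y z : 'rV[R]_d) (e : R) : ball y e z ->
  sqnorm2 (y - z) <= d%:R * e ^+ 2.
Proof.
move=> [e0 yz]; rewrite -[d in d%:R]card_ord mulr_natl -sumr_const.
apply: ler_sum => j _; rewrite !mxE -real_normK ?num_real// ler_sqr ?nnegrE//.
  exact/ltW/yz.
exact: ltW.
Qed.

(** The topology of row vectors is that of the maximum norm, hence the
    detour through [sqnorm2_ball]. *)
Lemma lipschitz_coord_continuous (K : R) (f : 'rV[R]_d -> R) : 0 <= K ->
  (forall y z, (f y - f z) ^+ 2 <= K * sqnorm2 (y - z)) -> continuous f.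
Proof.
move=> K0 fK y; apply/(@cvgrPdist_lt _ _ _ (nbhs (y : 'rV[R]_d)) (nbhs_filter _)) => e e0.
pose c := (K + 1) * (d%:R + 1).
have c1 : 1 <= c.
  by have := mulr_ge0 K0 (ler0n R d); have := ler0n R d; rewrite /c; lra.
have c0 : 0 < c by exact: lt_le_trans c1.
have ec0 : 0 < e / c by exact: divr_gt0.
apply/nbhs_ballP; exists (e / c) => //= z /sqnorm2_ball yz.
rewrite -(ltr_pXn2r (n := 2))// ?nnegrE ?(ltW e0)// real_normK ?num_real//.
apply: le_lt_trans (fK y z) _; apply: le_lt_trans (ler_wpM2l K0 yz) _.
have -> : e ^+ 2 = c * (c * (e / c) ^+ 2) by field; rewrite gt_eqF.
have : 0 < (e / c) ^+ 2 by exact: exprn_gt0.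
move: ((e / c) ^+ 2) => h h0; rewrite [K * _]mulrA [c * (c * h)]mulrA ltr_pM2r//.
apply: (@lt_le_trans _ _ c); last by rewrite ler_peMr// ltW.
by have := ler0n R d; rewrite /c; lra.
Qed.

Lemma lipschitz_borel_measurable (K : R) (g : 'rV[R]_d -> 'rV[R]_d) : 0 <= K ->
  (forall y z, sqnorm2 (g y - g z) <= K * sqnorm2 (y - z)) ->
  measurable_fun [set: borel_rV R d] (g : borel_rV R d -> borel_rV R d).
Proof.
move=> K0 gK; apply/measurable_rVP => j; apply: continuous_borel_measurable.
apply: (@lipschitz_coord_continuous K) => // y z; apply: le_trans (gK y z).
by have := sqr_coord_le (g y - g z) j; rewrite !mxE.
Qed.

Context {dT : measure_display} {T : measurableType dT}.
Implicit Types u v : T -> 'rV[R]_d.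
Local Notation borel u := (measurable_fun [set: T] (u : T -> borel_rV R d)).

Lemma borelD u v : borel u -> borel v -> borel (fun w => u w + v w).
Proof.
move=> /measurable_rVP mu /measurable_rVP mv; apply/measurable_rVP => j.
by under [X in measurable_fun _ X]funext => w do rewrite mxE; exact: measurable_funD.
Qed.

Lemma borelZ a u : borel u -> borel (fun w => a *: u w).
Proof.
move=> /measurable_rVP mu; apply/measurable_rVP => j.
by under [X in measurable_fun _ X]funext => w do rewrite mxE; exact: measurable_funM.
Qed.

Lemma borelB u v : borel u -> borel v -> borel (fun w => u w - v w).
Proof.
move=> mu /(borelZ (-1)) mv.
by under [X in measurable_fun _ X]funext => w do rewrite -scaleN1r; exact: borelD.
Qed.

Lemma borel_cst a : borel (fun=> a).
Proof. by apply/measurable_rVP => j; exact: measurable_cst. Qed.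

Lemma borel_sum (I : Type) (s : seq I) (u : I -> T -> 'rV[R]_d) :
  (forall i, borel (u i)) -> borel (fun w => \sum_(i <- s) u i w).
Proof.
move=> hu; elim: s => [|i s IH].
  by under [X in measurable_fun _ X]funext => w do rewrite big_nil; exact: borel_cst.
by under [X in measurable_fun _ X]funext => w do rewrite big_cons; exact: borelD.
Qed.

End BorelVector.

Section Dynamics.
Context {R : realType} {Omega : Type} {d n tau T : nat} {eta : R} {Xi : 'I_n -> Type}
  {xi : forall i : 'I_n, nat -> Omega -> Xi i}
  {G : forall i : 'I_n, 'rV[R]_d -> Xi i -> 'rV[R]_d} {x0 : 'rV[R]_d}
  {x : nat -> 'I_n -> Omega -> 'rV[R]_d}.
Hypothesis sgd : LocalSGD tau T eta xi G x0 x.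
Hypothesis n0 : (0 < n)%N.

Let g (t : nat) (i : 'I_n) (w : Omega) := @G i (x t i w) (xi i t w).

Lemma worker_mean_cst t w v : (forall i, x t i w = v) -> worker_mean x t w = v.
Proof.
move=> h; rewrite /worker_mean (eq_bigr (fun=> v)) => [|i _]; last exact: h.
rewrite sumr_const card_ord -[v *+ n]scaler_nat scalerA mulVf ?scale1r//.
by rewrite pnatr_eq0 -lt0n.
Qed.

Lemma local_step t i w : (t < T)%N -> ~~ (tau %| t.+1)%N ->
  x t.+1 i w = x t i w - eta *: g t i w.
Proof. by case: sgd => _ h tT /negbTE nt; rewrite h// nt. Qed.

(** At the start and after each communication all workers agree. *)
Lemma sync_step t i w : (t <= T)%N -> (tau %| t)%N -> x t i w = worker_mean x t w.
Proof.
case: sgd => h0 h; case: t => [_ _|t tT dt].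
  by rewrite h0 (@worker_mean_cst _ _ x0).
by apply/esym/worker_mean_cst => j; rewrite !h// dt.
Qed.

Let mean_local_step t w : (t < T)%N -> ~~ (tau %| t.+1)%N ->
  worker_mean x t.+1 w = worker_mean x t w - (eta / n%:R) *: \sum_j g t j w.
Proof.
move=> tT nt; rewrite /worker_mean (eq_bigr (fun i => x t i w - eta *: g t i w)).
  by rewrite sumrB scalerBr -scaler_sumr scalerA [eta / _]mulrC.
by move=> i _; exact: local_step.
Qed.

(** The workers' mean follows gradient descent along the average stochastic
    gradient, whether or not a communication takes place. *)
Lemma mean_step t w : (0 < tau)%N -> (t < T)%N ->
  worker_mean x t.+1 w = worker_mean x t w - (eta / n%:R) *: \sum_j g t j w.
Proof.
move=> tau0 tT; have [dt|] := boolP (tau %| t.+1)%N; last exact: mean_local_step.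
(* Within a round that starts at time [s] the mean accumulates the gradients. *)
have run s m : (tau %| s)%N -> (m < tau)%N -> (s + m <= T)%N ->
    worker_mean x (s + m)%N w
    = worker_mean x s w - (eta / n%:R) *: \sum_(k < m) \sum_j g (s + k)%N j w.
  move=> ds; elim: m => [_ _|m IH mt sT]; first by rewrite addn0 big_ord0 scaler0 subr0.
  rewrite addnS mean_local_step; last 2 first.
  - by rewrite addnS in sT.
  - by rewrite -addnS dvdn_addr// gtnNdvd.
  rewrite IH; [|exact: ltnW|by rewrite addnS in sT; exact: ltnW].
  by rewrite big_ord_recr/= scalerDr opprD addrA.
have [s ts] : exists s, t = (s + tau.-1)%N /\ (tau %| s)%N.
  exists (t.+1 - tau)%N; split; last by rewrite dvdn_subr// dvdn_leq.
  by have := dvdn_leq (ltn0Sn t) dt; lia.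
case: ts => tE ds.
rewrite (@worker_mean_cst t.+1 w (worker_mean x s w
    - (eta / n%:R) *: \sum_(j < n) \sum_(k < tau) g (t - k)%N j w)); last first.
  move=> i; case: sgd => _ ->//; rewrite dt; congr (worker_mean x _ w - _).
  by rewrite tE; lia.
rewrite {2}tE run//; [|by lia|by rewrite -tE; exact: ltnW].
rewrite -addrA -opprD -scalerDr; congr (_ - _ *: _).
(* The update sums the gradients of the round in reverse order of time. *)
rewrite exchange_big/= (reindex_inj rev_ord_inj)/=.
rewrite -(prednK tau0) big_ord_recr/=.
congr (_ + _).
  apply: eq_bigr => k _; apply: eq_bigr => j _; congr (g _ j w).
  by have := ltn_ord k; rewrite tE; lia.
by apply: eq_bigr => j _; congr (g _ j w); rewrite tE; lia.
Qed.

End Dynamics.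

(** Every iterate is a Borel function of the noise that precedes it. *)
Lemma LocalSGD_borel (R : realType) (dS dX : measure_display) (S : measurableType dS)
    (d n tau T m : nat) (eta : R) (Xi : 'I_n -> measurableType dX)
    (xi : forall i : 'I_n, nat -> S -> Xi i)
    (G : forall i : 'I_n, 'rV[R]_d -> Xi i -> 'rV[R]_d) (x0 : 'rV[R]_d)
    (x : nat -> 'I_n -> S -> 'rV[R]_d) :
  LocalSGD tau T eta xi G x0 x -> (m <= T)%N ->
  (forall i, measurable_fun [set: borel_rV R d * Xi i]
     (fun p : borel_rV R d * Xi i => G i p.1 p.2 : borel_rV R d)) ->
  (forall i s, (s < m)%N -> measurable_fun [set: S] (xi i s)) ->
  forall t i, (t <= m)%N -> measurable_fun [set: S] (x t i : S -> borel_rV R d).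
Proof.
move=> [h0 h] mT mG mxi; elim/ltn_ind => -[|t] IH i tm.
  by under [X in measurable_fun _ X]funext => w do rewrite h0; exact: borel_cst.
have mg s j : (s <= t)%N ->
    measurable_fun [set: S] (fun w => G j (x s j w) (xi j s w) : borel_rV R d).
  move=> st; have m1 : measurable_fun [set: S]
      (fun w => ((x s j w : borel_rV R d), xi j s w)).
    apply/measurable_fun_pairP; split; first by apply: IH; lia.
    by apply: mxi; lia.
  exact: (measurableT_comp (mG j) m1).
have tT : (t < T)%N by lia.
have [dt|/negbTE dt] := boolP (tau %| t.+1)%N; last first.
  under [X in measurable_fun _ X]funext => w do rewrite h// dt.
  by apply: borelB; [apply: IH; lia|apply/borelZ/mg].
under [X in measurable_fun _ X]funext => w do rewrite h// dt.
have tau0 : (0 < tau)%N by case: (tau) dt.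
apply: borelB; last first.
  by apply/borelZ/borel_sum => j; apply: borel_sum => k; apply: mg; lia.
by apply/borelZ/borel_sum => j; apply: IH; lia.
Qed.

Section Iterates.
Context {R : realType} {dO dX : measure_display} {Omega : measurableType dO}
  {P : probability Omega R} {d n tau T : nat} {L eta sigma : R}
  {Xi : 'I_n -> measurableType dX} {xi : forall i : 'I_n, nat -> {RV P >-> Xi i}}
  {G : forall i : 'I_n, 'rV[R]_d -> Xi i -> 'rV[R]_d} {x0 : 'rV[R]_d}
  {x : nat -> 'I_n -> Omega -> 'rV[R]_d} {gf : 'I_n -> 'rV[R]_d -> 'rV[R]_d}.
Hypothesis n0 : (0 < n)%N.
Hypothesis tau0 : (0 < tau)%N.
Hypothesis sgd : LocalSGD tau T eta xi G x0 x.
Hypothesis mG : forall i, measurable_fun [set: borel_rV R d * Xi i]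
  (fun p : borel_rV R d * Xi i => @G i p.1 p.2 : borel_rV R d).
Hypothesis ind : mutually_independent P
  (fun k : 'I_n * 'I_T => (xi k.1 k.2 : Omega -> Xi k.1)).
Hypothesis meanG : forall i t y, (t < T)%N ->
  has_mean P (fun w => @G i y (xi i t w)) (gf i y).
Hypothesis varG : forall i t y, (t < T)%N ->
  ('E_P[fun w => sqnorm2 (@G i y (xi i t w) - gf i y)] <= (sigma ^+ 2)%:E)%E.
Hypothesis gf_lip : forall i y z,
  sqnorm2 (gf i y - gf i z) <= L ^+ 2 * sqnorm2 (y - z).

(** The sampling error of worker [i] at iteration [t]. *)
Definition sample_noise (t : nat) (i : 'I_n) (w : Omega) : 'rV[R]_d :=
  @G i (x t i w) (xi i t w) - gf i (x t i w).

Local Notation X := (fun k : 'I_n * 'I_T => (xi k.1 k.2 : Omega -> Xi k.1)).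

(* The outcomes, with the events that do not depend on the noise of index
   [k]. *)
Local Notation past k := (g_sigma_algebraType (others X k)).

Let mX (k : 'I_n * 'I_T) : measurable_fun [set: Omega] (X k).
Proof. exact: measurable_funPT. Qed.

Let indX k A (B : set (Xi k.1)) : <<s others X k >> A -> measurable B ->
  (P (A `&` X k @^-1` B) = P A * P (X k @^-1` B))%E.
Proof. exact: (others_indep mX ind). Qed.

Let gf_borel i : measurable_fun [set: borel_rV R d] (gf i : borel_rV R d -> borel_rV R d).
Proof. by apply: (lipschitz_borel_measurable (sqr_ge0 L)) => y z; exact: gf_lip. Qed.

(** Iterates up to time [t] are functions of the noise variables other than that
    of worker [i] at time [t]. *)
Lemma iterate_past (i j : 'I_n) (s t : nat) (tT : (t < T)%N) : (s <= t)%N ->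
  measurable_fun [set: past (i, Ordinal tT)]
    (x s j : past (i, Ordinal tT) -> borel_rV R d).
Proof.
apply: (@LocalSGD_borel _ _ _ (past (i, Ordinal tT)) d n tau T t eta Xi
  (fun i s => (xi i s : Omega -> Xi i)) G x0 x sgd (ltnW tT) mG).
move=> i' s' st.
have sT : (s' < T)%N by exact: ltn_trans tT.
apply: (measurable_others (X := X) (k0 := (i, Ordinal tT)) (k := (i', Ordinal sT))).
by apply/eqP => -[_ e]; rewrite e ltnn in st.
Qed.

(** So are the sampling errors of the other workers at time [t]. *)
Lemma noise_past (i j : 'I_n) (t : nat) (tT : (t < T)%N) : j != i ->
  measurable_fun [set: past (i, Ordinal tT)]
    (sample_noise t j : past (i, Ordinal tT) -> borel_rV R d).
Proof.
move=> ji; have mx := @iterate_past i j t t tT (leqnn t).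
apply: borelB; last exact: (measurableT_comp (gf_borel j) mx).
have m1 : measurable_fun [set: past (i, Ordinal tT)]
    (fun w => ((x t j w : borel_rV R d), xi j t w)).
  apply/measurable_fun_pairP; split; first exact: mx.
  apply: (measurable_others (X := X) (k0 := (i, Ordinal tT)) (k := (j, Ordinal tT))).
  by apply/eqP => -[e]; rewrite e eqxx in ji.
exact: (measurableT_comp (mG (i:=j)) m1).
Qed.

Lemma sample_noise_vL2 t i : (t < T)%N -> vL2 P (sample_noise t i).
Proof.
move=> tT.
exact: (noise_vL2 (@mX (i, Ordinal tT)) (others_measurable mX (k0 := (i, Ordinal tT)))
  (@indX (i, Ordinal tT)) (@iterate_past i i t t tT (leqnn t)) (mG (i:=i))
  (@gf_borel i) (fun y => varG i y tT)).
Qed.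

Lemma mean_sqnorm2_sample_noise t i : (t < T)%N ->
  mean P (fun w => sqnorm2 (sample_noise t i w)) <= sigma ^+ 2.
Proof.
move=> tT.
exact: (mean_sqnorm2_noise (@mX (i, Ordinal tT))
  (others_measurable mX (k0 := (i, Ordinal tT)))
  (@indX (i, Ordinal tT)) (@iterate_past i i t t tT (leqnn t)) (mG (i:=i))
  (@gf_borel i) (fun y => varG i y tT)).
Qed.

Lemma mean_dot_sample_noise t i (tT : (t < T)%N) (Y : Omega -> 'rV[R]_d) :
  measurable_fun [set: past (i, Ordinal tT)] (Y : past (i, Ordinal tT) -> borel_rV R d) ->
  vL2 P Y -> mean P (fun w => dot (Y w) (sample_noise t i w)) = 0.
Proof.
move=> mY Y2.
exact: (mean_dot_noise (@mX (i, Ordinal tT))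
  (others_measurable mX (k0 := (i, Ordinal tT)))
  (@indX (i, Ordinal tT)) (@iterate_past i i t t tT (leqnn t)) (mG (i:=i))
  (@gf_borel i) (fun y => @meanG i t y tT) (fun y => varG i y tT) mY Y2).
Qed.

Lemma lipschitz_vL2 i (Y : Omega -> 'rV[R]_d) : vL2 P Y -> vL2 P (fun w => gf i (Y w)).
Proof.
move=> Y2.
apply: (@vL2_le _ _ _ _ _ _
  (fun w => 2 * (L ^+ 2 * sqnorm2 (Y w)) + 2 * sqnorm2 (gf i 0))).
- exact: (measurableT_comp (gf_borel i) (vL2_measurable Y2)).
- move=> w; have := gf_lip i (Y w) 0; rewrite subr0 => h.
  have := sqnorm2D_le (gf i (Y w) - gf i 0) (gf i 0); rewrite subrK => h2.
  apply: le_trans h2 _; rewrite lerD2r ler_wpM2l//.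
- apply: L1D; last exact: L1_cst.
  by apply/L1Z/L1Z/vL2_sqnorm2.
Qed.

Lemma iterate_vL2 t i : (t <= T)%N -> vL2 P (x t i).
Proof.
(* [lia] would make the statement depend on these hypotheses. *)
clear n0 tau0; case: (sgd) => h0 h; elim/ltn_ind: t i => -[|t] IH i tT.
  by under [X in vL2 _ X]funext => w do rewrite h0; exact: vL2_cst.
have g2 s j : (s <= t)%N -> vL2 P (fun w => @G j (x s j w) (xi j s w)).
  move=> st; have sT : (s < T)%N by lia.
  have := vL2D (sample_noise_vL2 j sT) (lipschitz_vL2 j (IH s _ j (ltnW sT))).
  by under [X in vL2 _ X]funext => w do rewrite /sample_noise subrK; apply; lia.
have [dt|/negbTE dt] := boolP (tau %| t.+1)%N; last first.
  under [X in vL2 _ X]funext => w do rewrite h// dt.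
  by apply: vL2B; [apply: IH; lia|apply/vL2Z/g2].
under [X in vL2 _ X]funext => w do rewrite h// dt.
apply: vL2B; first by apply/vL2Z/vL2_sum => j; apply: IH; lia.
by apply/vL2Z/vL2_sum => j; apply: vL2_sum => k; apply: g2; lia.
Qed.

Lemma mean_iterate_vL2 t : (t <= T)%N -> vL2 P (worker_mean x t).
Proof. by move=> tT; apply/vL2Z/vL2_sum => i; exact: iterate_vL2. Qed.

Lemma mean_iterate_past (i : 'I_n) (t : nat) (tT : (t < T)%N) :
  measurable_fun [set: past (i, Ordinal tT)]
    (worker_mean x t : past (i, Ordinal tT) -> borel_rV R d).
Proof. by apply/borelZ/borel_sum => j; exact: iterate_past. Qed.

(** The averaged noise is [n] times smaller than each worker's, in variance. *)
Lemma mean_sqnorm2_avg_noise t : (t < T)%N ->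
  mean P (fun w => sqnorm2 (vavg (fun i => sample_noise t i w))) <= sigma ^+ 2 / n%:R.
Proof.
move=> tT; have nr : 0 < n%:R :> R by rewrite ltr0n.
have N2 := fun i => sample_noise_vL2 i tT.
have E w : sqnorm2 (vavg (fun i => sample_noise t i w))
    = n%:R^-1 ^+ 2 * \sum_i \sum_j dot (sample_noise t j w) (sample_noise t i w).
  rewrite /vavg sqnorm2Z -dotvv dot_sumr; congr (_ * _).
  by apply: eq_bigr => i _; rewrite dot_suml.
under [X in mean P X]funext => w do rewrite E.
rewrite meanZ; last by apply: L1_sum => i; apply: L1_sum => j; exact: vL2_dot.
rewrite mean_sum; last by move=> i; apply: L1_sum => j; exact: vL2_dot.
have -> : sigma ^+ 2 / n%:R = n%:R^-1 ^+ 2 * \sum_(i < n) sigma ^+ 2.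
  by rewrite sumr_const card_ord -[sigma ^+ 2 *+ n]mulr_natl; field; rewrite gt_eqF.
rewrite ler_wpM2l ?sqr_ge0//; apply: ler_sum => i _.
rewrite mean_sum; last by move=> j; exact: vL2_dot.
rewrite (bigD1 i)//= big1 ?addr0.
  under [X in mean P X]funext => w do rewrite dotvv.
  exact: mean_sqnorm2_sample_noise.
by move=> j ji; apply: (@mean_dot_sample_noise _ _ tT) => //; exact: noise_past.
Qed.

End Iterates.

(** * Recursions in expectation *)

Section Recursions.
Context {R : realType} {dO dX : measure_display} {Omega : measurableType dO}
  {P : probability Omega R} {d n tau T : nat} {L rho eta sigma zeta Flow : R}
  {Xi : 'I_n -> measurableType dX} {xi : forall i : 'I_n, nat -> {RV P >-> Xi i}}
  {G : forall i : 'I_n, 'rV[R]_d -> Xi i -> 'rV[R]_d} {x0 : 'rV[R]_d}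
  {x : nat -> 'I_n -> Omega -> 'rV[R]_d} {F : 'rV[R]_d -> R}
  {gF : 'rV[R]_d -> 'rV[R]_d} {gf : 'I_n -> 'rV[R]_d -> 'rV[R]_d}.
Hypothesis n0 : (0 < n)%N.
Hypothesis sgd : LocalSGD tau T eta xi G x0 x.
Hypothesis mG : forall i, measurable_fun [set: borel_rV R d * Xi i]
  (fun p : borel_rV R d * Xi i => @G i p.1 p.2 : borel_rV R d).
Hypothesis ind : mutually_independent P
  (fun k : 'I_n * 'I_T => (xi k.1 k.2 : Omega -> Xi k.1)).
Hypothesis meanG : forall i t y, (t < T)%N ->
  has_mean P (fun w => @G i y (xi i t w)) (gf i y).
Hypothesis varG : forall i t y, (t < T)%N ->
  ('E_P[fun w => sqnorm2 (@G i y (xi i t w) - gf i y)] <= (sigma ^+ 2)%:E)%E.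
Hypotheses (L0 : 0 < L) (r0 : 0 <= rho) (e0 : 0 < eta) (tau2 : (2 <= tau)%N)
  (eL : 4 * L * eta <= 1) (er : 4 * rho * eta * tau%:R <= 1).
Hypothesis gFE : forall y, gF y = vavg (gf^~ y).
Hypothesis gf_lip : forall i y z,
  sqnorm2 (gf i y - gf i z) <= L ^+ 2 * sqnorm2 (y - z).
Hypothesis gf_coco : forall i y z,
  sqnorm2 (gf i y - gf i z) / (4 * L) - 3 / 2 * rho * sqnorm2 (y - z)
  <= dot (gf i y - gf i z) (y - z).
Hypothesis gf_sim : forall y,
  n%:R^-1 * \sum_i sqnorm2 (gf i y - gF y) <= zeta ^+ 2.
Hypothesis F_desc : forall y v,
  F (y + v) <= F y + dot (gF y) v + L / 2 * sqnorm2 v.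
Hypothesis F_low : forall y, Flow <= F y.
Hypothesis F_cont : continuous F.

Let tau0 : (0 < tau)%N. Proof. exact: leq_trans tau2. Qed.
Let nr : 0 < n%:R :> R. Proof. by rewrite ltr0n. Qed.

Let tr : 0 < tau%:R :> R. Proof. by rewrite ltr0n. Qed.

Let k_ge0 : 0 <= eta ^+ 2 * (2 * tau%:R * zeta ^+ 2 + sigma ^+ 2).
Proof.
apply: mulr_ge0; first exact: sqr_ge0.
apply: addr_ge0; last exact: sqr_ge0.
by apply: mulr_ge0; [exact: mulr_ge0|exact: sqr_ge0].
Qed.

Local Notation xbar := (worker_mean x).
Local Notation noise := (@sample_noise _ _ _ _ _ _ _ _ xi G x gf).

(** The mean square distance of the workers to their mean. *)
Definition spread (t : nat) (w : Omega) : R :=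
  n%:R^-1 * \sum_i sqnorm2 (x t i w - xbar t w).

Let noiseE t i w : gf i (x t i w) + noise t i w = @G i (x t i w) (xi i t w).
Proof. by rewrite /sample_noise addrC subrK. Qed.

Let x2 t i : (t <= T)%N -> vL2 P (x t i).
Proof. exact: (iterate_vL2 sgd mG ind varG gf_lip). Qed.

Let xb2 t : (t <= T)%N -> vL2 P (xbar t).
Proof. exact: (mean_iterate_vL2 sgd mG ind varG gf_lip). Qed.

Let N2 t i : (t < T)%N -> vL2 P (noise t i).
Proof. exact: (sample_noise_vL2 sgd mG ind varG gf_lip). Qed.

Let gf2 i Y : vL2 P Y -> vL2 P (fun w => gf i (Y w)).
Proof. exact: (lipschitz_vL2 gf_lip). Qed.

Let gF2 Y : vL2 P Y -> vL2 P (fun w => gF (Y w)).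
Proof.
move=> Y2; under [X in vL2 _ X]funext => w do rewrite gFE.
by apply/vL2Z/vL2_sum => i; exact: gf2.
Qed.

Let gf_borel i : measurable_fun [set: borel_rV R d] (gf i : borel_rV R d -> borel_rV R d).
Proof. by apply: (lipschitz_borel_measurable (sqr_ge0 L)) => y z; exact: gf_lip. Qed.

Let gF_borel : measurable_fun [set: borel_rV R d] (gF : borel_rV R d -> borel_rV R d).
Proof.
under [X in measurable_fun _ X]funext => y do rewrite gFE.
by apply/borelZ/borel_sum => i; exact: gf_borel.
Qed.

Let spread1 t : (t <= T)%N -> L1 P (spread t).
Proof.
by move=> tT; apply/L1Z/L1_sum => i; apply/vL2_sqnorm2/vL2B; [exact: x2|exact: xb2].
Qed.

(** At a communication the spread vanishes; otherwise [consensus_step] applies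
    and the noise is centred given the past. *)
Lemma mean_spread_step t : (t < T)%N ->
  mean P (spread t.+1)
  <= (1 + 2 / tau%:R) * mean P (spread t)
     + eta ^+ 2 * (2 * tau%:R * zeta ^+ 2 + sigma ^+ 2).
Proof.
move=> tT; have tT' := ltnW tT.
have [dt|nt] := boolP (tau %| t.+1)%N.
  under [X in mean P X]funext => w.
    rewrite /spread big1 ?mulr0; last first.
      by move=> i _; rewrite (sync_step sgd)// subrr sqnorm2_0.
    over.
  rewrite mean_cst; apply: addr_ge0; last exact: k_ge0.
  apply: mulr_ge0; first by rewrite addr_ge0// divr_ge0.
  apply: mean_ge0 => w; apply: mulr_ge0; first by rewrite invr_ge0.
  by apply: sumr_ge0 => i _; exact: sqnorm2_ge0.
pose S1 w := n%:R^-1 *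
  \sum_i dot (drift (eta := eta) gF gf (fun i => x t i w) i) (noise t i w).
pose S2 w := n%:R^-1 * \sum_i sqnorm2 (noise t i w).
have drift2 i : vL2 P (fun w => drift (eta := eta) gF gf (fun i => x t i w) i).
  apply: vL2B; first by apply: vL2B; [exact: x2|exact: xb2].
  by apply/vL2Z/vL2B; [apply/gf2/x2|apply/gF2/xb2].
have S11 : L1 P S1 by apply/L1Z/L1_sum => i; apply: vL2_dot => //; exact: N2.
have S21 : L1 P S2 by apply/L1Z/L1_sum => i; apply/vL2_sqnorm2/N2.
have S1E : mean P S1 = 0.
  rewrite meanZ; last by apply: L1_sum => i; apply: vL2_dot => //; exact: N2.
  rewrite mean_sum; last by move=> i; apply: vL2_dot => //; exact: N2.
  rewrite big1 ?mulr0// => i _.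
  apply: (mean_dot_sample_noise sgd mG ind meanG varG gf_lip (tT := tT)) => //.
  have mx j := iterate_past sgd mG (i := i) j (tT := tT) (leqnn t).
  have mxb := mean_iterate_past sgd mG (i := i) (tT := tT).
  apply: borelB; first by apply: borelB; [exact: mx|exact: mxb].
  apply/borelZ/borelB; first exact: (measurableT_comp (@gf_borel i) (mx i)).
  exact: (measurableT_comp gF_borel mxb).
have S2E : mean P S2 <= sigma ^+ 2.
  rewrite meanZ; last by apply: L1_sum => i; apply/vL2_sqnorm2/N2.
  rewrite mean_sum; last by move=> i; apply/vL2_sqnorm2/N2.
  rewrite ler_pdivrMl//; apply: le_trans (ler_sum _ (fun i _ =>
    mean_sqnorm2_sample_noise sgd mG ind varG gf_lip i tT)) _.
  by rewrite sumr_const card_ord -[sigma ^+ 2 *+ n]mulr_natl.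
have pt w : spread t.+1 w <= (1 + 2 / tau%:R) * spread t w
    + (eta ^+ 2 * (2 * tau%:R) * zeta ^+ 2 + (- (2 * eta) * S1 w + eta ^+ 2 * S2 w)).
  have := consensus_step n0 L0 r0 e0 tau2 eL er gf_coco gf_sim
    (fun i => x t i w) (fun i => noise t i w).
  rewrite (_ : (fun i => _ - eta *: _) = (fun i => x t.+1 i w)); last first.
    by apply/funext => i; rewrite noiseE (local_step sgd).
  move=> h; apply: le_trans h _; rewrite /spread /S1 /S2.
  by rewrite mulNr !addrA.
have L1r : L1 P (fun w => - (2 * eta) * S1 w + eta ^+ 2 * S2 w).
  by apply: L1D; exact: L1Z.
apply: le_trans (mean_le (spread1 tT) _ pt) _.
  apply: L1D; first exact/L1Z/spread1.
  by apply: L1D => //; exact: L1_cst.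
rewrite meanD; [|exact/L1Z/spread1|by apply: L1D => //; exact: L1_cst].
rewrite (meanZ _ (spread1 tT')) meanD ?mean_cst//; last exact: L1_cst.
rewrite meanD; [|exact: L1Z|exact: L1Z].
rewrite (meanZ _ S11) (meanZ _ S21) S1E mulr0 add0r lerD2l.
rewrite mulrDr [eta ^+ 2 * (_ * _ * _)]mulrA lerD2l.
by apply: ler_wpM2l => //; exact: sqr_ge0.
Qed.

(** The spread starts from 0 at each communication and grows for at most [tau]
    steps, over which the factor [1 + 2 / tau] compounds to at most [expR 2]. *)
Lemma mean_spread t : (t <= T)%N ->
  mean P (spread t)
  <= expR 2 * (tau%:R * (eta ^+ 2 * (2 * tau%:R * zeta ^+ 2 + sigma ^+ 2))).
Proof.
set k := eta ^+ 2 * _ => tT.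
have k0 : 0 <= k.
  exact: k_ge0.
have q1 : 1 <= 1 + 2 / tau%:R :> R by rewrite lerDl divr_ge0.
have q0 : 0 <= 1 + 2 / tau%:R :> R by exact: le_trans q1.
have run s m : (tau %| s)%N -> (s + m <= T)%N ->
    mean P (spread (s + m)) <= (1 + 2 / tau%:R) ^+ m * (m%:R * k).
  move=> ds; elim: m => [sT|m IH sT].
    rewrite addn0 mul0r mulr0.
    under [X in mean P X]funext => w.
      rewrite /spread big1 ?mulr0; last first.
        move=> i _; rewrite (sync_step sgd)// ?subrr ?sqnorm2_0//.
        by rewrite addn0 in sT.
      over.
    by rewrite mean_cst.
  rewrite addnS in sT *; apply: le_trans (mean_spread_step sT) _.
  have := ler_wpM2l q0 (IH (ltnW sT)); rewrite -/k => h.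
  apply: le_trans (lerD h (lexx k)) _.
  have -> : (1 + 2 / tau%:R) ^+ m.+1 * (m.+1%:R * k)
      = (1 + 2 / tau%:R) * ((1 + 2 / tau%:R) ^+ m * (m%:R * k))
        + (1 + 2 / tau%:R) ^+ m.+1 * k by rewrite exprS -natr1; ring.
  rewrite lerD2l.
  by rewrite ler_peMl// exprn_ege1.
rewrite (divn_eq t tau); apply: le_trans (run _ _ _ _) _.
- exact: dvdn_mull.
- by rewrite -divn_eq.
have mt : (t %% tau)%:R <= tau%:R :> R by rewrite ler_nat ltnW// ltn_mod.
apply: ler_pM => //.
- by rewrite mulr_ge0.
- apply: le_trans (_ : expR (2 / tau%:R) ^+ (t %% tau) <= _).
    by apply: lerXn2r; rewrite ?nnegrE ?expR_ge0// expR_ge1Dx.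
  rewrite -expRM_natl ler_expR mulrCA -[leRHS]mulr1 ler_wpM2l//.
  by rewrite ler_pdivrMr// mul1r.
- by rewrite ler_wpM2r.
Qed.

Let F1 t : (t <= T)%N -> L1 P (fun w => F (xbar t w)).
Proof.
move=> tT; have X2 := xb2 tT.
pose U w := F 0 + dot (gF 0) (xbar t w) + L / 2 * sqnorm2 (xbar t w) - Flow.
have U1 : L1 P U.
  apply: L1B; last exact: L1_cst.
  apply: L1D; last by apply/L1Z/vL2_sqnorm2.
  by apply: L1D; [exact: L1_cst|apply: vL2_dot => //; exact: vL2_cst].
have mF : measurable_fun [set: Omega] (fun w => F (xbar t w)).
  exact: (measurableT_comp (continuous_borel_measurable F_cont) (vL2_measurable X2)).
have h : L1 P (fun w => F (xbar t w) - Flow).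
  apply: L1_le U1; first exact: measurable_funB.
  move=> w; rewrite ger0_norm ?subr_ge0// lerD2r.
  by have := F_desc 0 (xbar t w); rewrite add0r.
have := L1D h (L1_cst P Flow).
by under [X in L1 P X -> _]funext => w do rewrite subrK.
Qed.

Lemma mean_descent_step t : (t < T)%N ->
  mean P (fun w => F (xbar t.+1 w))
  <= mean P (fun w => F (xbar t w))
     - eta / 2 * mean P (fun w => sqnorm2 (gF (xbar t w)))
     + eta * L ^+ 2 / 2 * mean P (spread t)
     + L * eta ^+ 2 / 2 * (sigma ^+ 2 / n%:R).
Proof.
move=> tT; have tT' := ltnW tT.
pose W w := (L * eta ^+ 2) *: vavg (fun i => gf i (x t i w)) - eta *: gF (xbar t w).
pose nu w := vavg (fun i => noise t i w).
have W2 : vL2 P W.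
  apply: vL2B; last by apply/vL2Z/gF2/xb2.
  by apply/vL2Z/vL2Z/vL2_sum => i; apply/gf2/x2.
have nu2 : vL2 P nu by apply/vL2Z/vL2_sum => i; exact: N2.
have E1 : mean P (fun w => dot (W w) (nu w)) = 0.
  under [X in mean P X]funext => w do rewrite /nu /vavg dotZr dot_sumr.
  rewrite meanZ; last by apply: L1_sum => i; apply: vL2_dot => //; exact: N2.
  rewrite mean_sum; last by move=> i; apply: vL2_dot => //; exact: N2.
  rewrite big1 ?mulr0// => i _.
  apply: (mean_dot_sample_noise sgd mG ind meanG varG gf_lip (tT := tT)) => //.
  have mx j := iterate_past sgd mG (i := i) j (tT := tT) (leqnn t).
  have mxb := mean_iterate_past sgd mG (i := i) (tT := tT).
  apply: borelB; last by apply: borelZ; exact: (measurableT_comp gF_borel mxb).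
  by apply/borelZ/borelZ/borel_sum => j; exact: (measurableT_comp (@gf_borel j) (mx j)).
have E2 : mean P (fun w => sqnorm2 (nu w)) <= sigma ^+ 2 / n%:R.
  exact: (mean_sqnorm2_avg_noise n0 sgd mG ind meanG varG gf_lip tT).
have pt w : F (xbar t.+1 w) <= F (xbar t w)
    + (- (eta / 2) * sqnorm2 (gF (xbar t w))
    + (eta * L ^+ 2 / 2 * spread t w
    + (dot (W w) (nu w) + L * eta ^+ 2 / 2 * sqnorm2 (nu w)))).
  have := descent_step n0 L0 e0 eL gFE gf_lip F_desc
    (fun i => x t i w) (fun i => noise t i w).
  (* [worker_mean] is [vavg] of the iterates by definition. *)
  rewrite -[vavg (fun i => x t i w)]/(xbar t w).
  cbv zeta.  rewrite (_ : xbar t w - _ = xbar t.+1 w); last first.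
    rewrite (mean_step sgd n0 w tau0 tT) /vavg -scalerDr -big_split/= scalerA.
    by congr (_ - _ *: _); apply: eq_bigr => i _; rewrite noiseE.
  move=> h; apply: le_trans h _.
  by rewrite /W /nu /spread mulNr !addrA.
have l1 : L1 P (fun w => sqnorm2 (gF (xbar t w))) by apply/vL2_sqnorm2/gF2/xb2.
have l2 : L1 P (fun w => dot (W w) (nu w)) by exact: vL2_dot.
have l3 : L1 P (fun w => sqnorm2 (nu w)) by exact: vL2_sqnorm2.
have l4 := spread1 tT'.
have l23 := L1D l2 (L1Z (L * eta ^+ 2 / 2) l3).
have l423 := L1D (L1Z (eta * L ^+ 2 / 2) l4) l23.
have l1423 := L1D (L1Z (- (eta / 2)) l1) l423.
apply: le_trans (mean_le (F1 tT) (L1D (F1 tT') l1423) pt) _.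
rewrite (meanD (F1 tT') l1423) (meanD (L1Z _ l1) l423) (meanD (L1Z _ l4) l23).
rewrite (meanD l2 (L1Z _ l3)) E1 add0r (meanZ _ l1) (meanZ _ l4) (meanZ _ l3).
rewrite mulNr !addrA lerD2l ler_wpM2l// mulr_ge0 ?invr_ge0//.
by rewrite mulr_ge0 ?sqr_ge0// ltW.
Qed.

(** Telescoping the expected descent. *)
Lemma sum_mean_sqnorm2_grad :
  \sum_(t < T) mean P (fun w => sqnorm2 (gF (xbar t w)))
  <= 2 / eta * (F x0 - Flow)
     + T%:R * (L ^+ 2 * (expR 2 *
                 (tau%:R * (eta ^+ 2 * (2 * tau%:R * zeta ^+ 2 + sigma ^+ 2))))
               + L * eta * (sigma ^+ 2 / n%:R)).
Proof.
set K := expR 2 * _; set s := sigma ^+ 2 / _.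
pose a t := mean P (fun w => F (xbar t w)).
pose g t := mean P (fun w => sqnorm2 (gF (xbar t w))).
have step t : (t < T)%N ->
    g t <= 2 / eta * (a t - a t.+1) + (L ^+ 2 * K + L * eta * s).
  move=> tT; have h1 := mean_descent_step tT; have h2 := mean_spread (ltnW tT).
  have aux (p q u D : R) : q <= p - eta / 2 * u + eta * L ^+ 2 / 2 * D
      + L * eta ^+ 2 / 2 * s -> D <= K ->
      u <= 2 / eta * (p - q) + (L ^+ 2 * K + L * eta * s).
    move=> h3 /(ler_wpM2l (sqr_ge0 L)) h4.
    have ei : 0 <= 2 / eta by rewrite divr_ge0// ltW.
    have := ler_wpM2l ei h3.
    have -> : 2 / eta * (p - eta / 2 * u + eta * L ^+ 2 / 2 * D + L * eta ^+ 2 / 2 * s)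
       = 2 / eta * p - u + L ^+ 2 * D + L * eta * s by field; rewrite gt_eqF.
    lra.
  exact: aux h1 h2.
have tele m : (m <= T)%N ->
    \sum_(t < m) g t <= 2 / eta * (a 0%N - a m) + m%:R * (L ^+ 2 * K + L * eta * s).
  elim: m => [_|m IH mT]; first by rewrite big_ord0 subrr mulr0 mul0r addr0.
  rewrite big_ord_recr/= -natr1.
  have := lerD (IH (ltnW mT)) (step _ mT).
  move: (\sum_(t < m) g t) (g m) (a 0%N) (a m) (a m.+1) (L ^+ 2 * K + _) => p q u v z k.
  lra.
apply: le_trans (tele T (leqnn T)) _; rewrite lerD2r.
apply: ler_wpM2l; first by rewrite divr_ge0// ltW.
have -> : a 0%N = F x0.
  rewrite /a; under [X in mean P X]funext => w.
    rewrite (worker_mean_cst n0 (v := x0)); last by move=> i; case: sgd.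
    over.
  exact: mean_cst.
rewrite lerD2l lerN2 -[Flow](mean_cst P).
by apply: mean_le; [exact: L1_cst|exact: F1|move=> w; exact: F_low].
Qed.

Lemma expectation_sqnorm2_grad t : (t <= T)%N ->
  ('E_P[fun w => sqnorm2 (gF (xbar t w))]
   = (mean P (fun w => sqnorm2 (gF (xbar t w))))%:E)%E.
Proof. by move=> tT; apply/expectation_mean/vL2_sqnorm2/gF2/xb2. Qed.

End Recursions.

(** * The stepsize *)

Section CubeRoot.
Context {R : realType}.
Implicit Types x y : R.

Lemma cbrtK x : 0 <= x -> (x `^ (1 / 3)) ^+ 3 = x.
Proof.
move=> x0; rewrite -powR_mulrn ?powR_ge0// -powRrM.
by rewrite div1r mulVf ?pnatr_eq0// powRr1.
Qed.

Lemma exprK_cbrt x : 0 <= x -> (x ^+ 3) `^ (1 / 3) = x.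
Proof.
move=> x0; rewrite -powR_mulrn// -powRrM.
by rewrite div1r mulfV ?pnatr_eq0// powRr1.
Qed.

Lemma powR23E x : 0 <= x -> x `^ (2 / 3) = (x ^+ 2) `^ (1 / 3).
Proof. by move=> x0; rewrite -powR_mulrn// -powRrM div1r. Qed.

End CubeRoot.

Section Stepsize.
Context {R : realType} (L Delta sigma zeta rho : R) (n tau r : nat).
Hypotheses (L0 : 0 < L) (D0 : 0 < Delta) (s0 : 0 <= sigma) (z0 : 0 <= zeta)
  (r0 : 0 <= rho) (n0 : (0 < n)%N) (tau0 : (0 < tau)%N) (rr0 : (0 < r)%N).

Let T := (tau * r)%N.
Let nR : 0 < n%:R :> R. Proof. by rewrite ltr0n. Qed.
Let tR : 0 < tau%:R :> R. Proof. by rewrite ltr0n. Qed.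
Let rR : 0 < r%:R :> R. Proof. by rewrite ltr0n. Qed.
Let TE : T%:R = tau%:R * r%:R :> R. Proof. by rewrite natrM. Qed.
Let TR : 0 < T%:R :> R. Proof. by rewrite TE mulr_gt0. Qed.

(** The summands of the inverse stepsize that come from the variance of the
    averaged noise, from the dissimilarity and from the local variance. *)
Definition step_a : R := Num.sqrt (L * sigma ^+ 2 * T%:R / (Delta * n%:R)).
Definition step_b : R := (L ^+ 2 * tau%:R ^+ 2 * zeta ^+ 2 * T%:R / Delta) `^ (1 / 3).
Definition step_c : R := (L ^+ 2 * tau%:R * sigma ^+ 2 * T%:R / Delta) `^ (1 / 3).

(** The stepsize: the inverse of the sum of the inverses of the stepsizes that
    balance the optimization term against the constraint
    [1 / (4 * (L + rho * tau))], the averaged variance, the dissimilarity and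
    the local variance, respectively. As it is the inverses that are added, a
    zero [sigma] or [zeta] needs no special treatment. *)
Definition stepsize : R := (4 * (L + rho * tau%:R) + step_a + step_b + step_c)^-1.

Let a0 : 0 <= step_a. Proof. exact: sqrtr_ge0. Qed.
Let b0 : 0 <= step_b. Proof. exact: powR_ge0. Qed.
Let c0 : 0 <= step_c. Proof. exact: powR_ge0. Qed.

Let rt0 : 0 <= rho * tau%:R. Proof. by rewrite mulr_ge0// ltW. Qed.

Let inv0 : 0 < 4 * (L + rho * tau%:R) + step_a + step_b + step_c.
Proof. by move: L0 a0 b0 c0 rt0; lra. Qed.

Lemma stepsize_gt0 : 0 < stepsize.
Proof. by rewrite invr_gt0. Qed.

Let stepsize_le k : 0 <= k -> k <= 4 * (L + rho * tau%:R) + step_a + step_b + step_c ->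
  k * stepsize <= 1.
Proof. by move=> k0 kle; rewrite ler_pdivrMr// mul1r. Qed.

Lemma stepsizeL : 4 * L * stepsize <= 1.
Proof. by apply: stepsize_le; move: L0 a0 b0 c0 rt0; lra. Qed.

Lemma stepsize_rho : 4 * rho * stepsize * tau%:R <= 1.
Proof.
have -> : 4 * rho * stepsize * tau%:R = 4 * (rho * tau%:R) * stepsize by ring.
by apply: stepsize_le; move: L0 a0 b0 c0 rt0; lra.
Qed.

Let a_sqr : L * sigma ^+ 2 / n%:R = step_a ^+ 2 * (Delta / T%:R).
Proof.
rewrite sqr_sqrtr; first by field; rewrite !gt_eqF.
by rewrite divr_ge0 ?mulr_ge0 ?sqr_ge0// ltW// mulr_gt0.
Qed.

Let b_cube : L ^+ 2 * tau%:R ^+ 2 * zeta ^+ 2 = step_b ^+ 3 * (Delta / T%:R).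
Proof.
rewrite cbrtK; first by field; rewrite !gt_eqF.
by rewrite divr_ge0 ?mulr_ge0 ?sqr_ge0// ltW.
Qed.

Let c_cube : L ^+ 2 * tau%:R * sigma ^+ 2 = step_c ^+ 3 * (Delta / T%:R).
Proof.
rewrite cbrtK; first by field; rewrite !gt_eqF.
by rewrite divr_ge0 ?mulr_ge0 ?sqr_ge0// ltW.
Qed.

Let aE : Delta / T%:R * step_a
  = Num.sqrt (L * Delta * sigma ^+ 2 / (n%:R * tau%:R * r%:R)).
Proof.
have h : 0 <= Delta / T%:R by rewrite divr_ge0// ltW.
rewrite -[X in X * _](ger0_norm h) -sqrtr_sqr -sqrtrM ?sqr_ge0//; congr Num.sqrt.
by rewrite TE; field; rewrite !gt_eqF.
Qed.

Let bE : Delta / T%:R * step_b = (L * Delta * zeta / r%:R) `^ (2 / 3).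
Proof.
have h : 0 <= Delta / T%:R by rewrite divr_ge0// ltW.
rewrite powR23E; last by rewrite divr_ge0 ?mulr_ge0// ltW.
rewrite -[X in X * _](exprK_cbrt h) -powRM ?exprn_ge0//; last first.
  by rewrite divr_ge0 ?mulr_ge0 ?sqr_ge0// ltW.
by congr (_ `^ _); rewrite TE; field; rewrite !gt_eqF.
Qed.

Let cE : Delta / T%:R * step_c
  = (L * Delta * sigma) `^ (2 / 3) / (tau%:R `^ (1 / 3) * r%:R `^ (2 / 3)).
Proof.
have h : 0 <= Delta / T%:R by rewrite divr_ge0// ltW.
have t1 : 0 < tau%:R `^ (1 / 3) * r%:R `^ (2 / 3) :> R by rewrite mulr_gt0 ?powR_gt0.
apply: (canRL (mulfK (lt0r_neq0 t1))).
rewrite [r%:R `^ _]powR23E ?(ltW rR)// powR23E; last by rewrite !mulr_ge0// ltW.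
rewrite -{1}(exprK_cbrt h).
have c1 : 0 <= L ^+ 2 * tau%:R * sigma ^+ 2 * T%:R / Delta.
  by rewrite divr_ge0 ?mulr_ge0 ?sqr_ge0// ltW.
have r2 : 0 <= r%:R ^+ 2 :> R by exact: sqr_ge0.
have h3 : 0 <= (Delta / T%:R) ^+ 3 by exact: exprn_ge0.
rewrite -(powRM _ h3 c1) -(powRM _ (ltW tR) r2).
rewrite -powRM ?(mulr_ge0 h3 c1) ?(mulr_ge0 (ltW tR) r2)//.
by congr (_ `^ _); rewrite TE; field; rewrite !gt_eqF.
Qed.

(** Each higher-order term is at most the corresponding part of
    [Delta / (T * stepsize)], and [Delta / T] times each summand of
    [stepsize^-1] is one of the terms of the rate. *)
Lemma stepsize_rate :
  T%:R^-1 * (2 / stepsize * Delta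
     + T%:R * (L ^+ 2 * (expR 2 *
                 (tau%:R * (stepsize ^+ 2 * (2 * tau%:R * zeta ^+ 2 + sigma ^+ 2))))
               + L * stepsize * (sigma ^+ 2 / n%:R)))
  <= (8 + 2 * expR 2) *
     ((L / tau%:R + rho) * (Delta / r%:R)
      + Num.sqrt (L * Delta * sigma ^+ 2 / (n%:R * tau%:R * r%:R))
      + (L * Delta * zeta / r%:R) `^ (2 / 3)
      + (L * Delta * sigma) `^ (2 / 3) / (tau%:R `^ (1 / 3) * r%:R `^ (2 / 3))).
Proof.
have et := stepsize_gt0.
have ea : step_a * stepsize <= 1 by apply: stepsize_le => //; move: L0 a0 b0 c0 rt0; lra.
have eb : step_b * stepsize <= 1 by apply: stepsize_le => //; move: L0 a0 b0 c0 rt0; lra.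
have ec : step_c * stepsize <= 1 by apply: stepsize_le => //; move: L0 a0 b0 c0 rt0; lra.
have x0 : 0 <= expR 2 :> R by exact: expR_ge0.
have q0 : 0 <= Delta / T%:R by rewrite divr_ge0// ltW.
rewrite -aE -bE -cE.
have -> : (L / tau%:R + rho) * (Delta / r%:R) = Delta / T%:R * (L + rho * tau%:R).
  by rewrite TE; field; rewrite !gt_eqF.
have -> : T%:R^-1 * (2 / stepsize * Delta
     + T%:R * (L ^+ 2 * (expR 2 *
                 (tau%:R * (stepsize ^+ 2 * (2 * tau%:R * zeta ^+ 2 + sigma ^+ 2))))
               + L * stepsize * (sigma ^+ 2 / n%:R)))
  = 2 * (Delta / T%:R) * stepsize^-1
    + (2 * expR 2 * (stepsize ^+ 2 * (L ^+ 2 * tau%:R ^+ 2 * zeta ^+ 2))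
       + expR 2 * (stepsize ^+ 2 * (L ^+ 2 * tau%:R * sigma ^+ 2))
       + stepsize * (L * sigma ^+ 2 / n%:R)).
  by field; rewrite !gt_eqF.
rewrite a_sqr b_cube c_cube {1}/stepsize invrK.
move: stepsize step_a step_b step_c a0 b0 c0 et ea eb ec => e a b c ha hb hc et ea eb ec.
have {}ea : e * (a ^+ 2 * (Delta / T%:R)) <= a * (Delta / T%:R).
  have -> : e * (a ^+ 2 * (Delta / T%:R)) = (a * e) * (a * (Delta / T%:R)) by ring.
  by rewrite ler_piMl// mulr_ge0.
have cube k : 0 <= k -> k * e <= 1 ->
    e ^+ 2 * (k ^+ 3 * (Delta / T%:R)) <= k * (Delta / T%:R).
  move=> hk ek; have -> : e ^+ 2 * (k ^+ 3 * (Delta / T%:R))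
    = (k * e) ^+ 2 * (k * (Delta / T%:R)) by ring.
  apply: ler_piMl; first exact: mulr_ge0.
  by apply: exprn_ile1 => //; rewrite mulr_ge0// ltW.
have {}eb := ler_wpM2l x0 (cube _ hb eb).
have {}ec := ler_wpM2l x0 (cube _ hc ec).
have h1 : 0 <= a * (Delta / T%:R) by rewrite mulr_ge0.
have h2 : 0 <= b * (Delta / T%:R) by rewrite mulr_ge0.
have h3 : 0 <= c * (Delta / T%:R) by rewrite mulr_ge0.
have h4 : 0 <= (L + rho * tau%:R) * (Delta / T%:R).
  by rewrite mulr_ge0// addr_ge0// ltW.
have m1 := mulr_ge0 x0 h1; have m2 := mulr_ge0 x0 h2.
have m3 := mulr_ge0 x0 h3; have m4 := mulr_ge0 x0 h4.
move: (Delta / T%:R) h1 h2 h3 h4 m1 m2 m3 m4 ea eb ec => q.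
lra.
Qed.

End Stepsize.

(** * The convergence rate *)

Unset Implicit Arguments.

Theorem theorem1 (R : realType) :
  exists C : R, 0 < C /\
  forall (L Delta sigma zeta rho : R) (n tau rounds : nat),
    0 < L -> 0 < Delta -> 0 <= sigma -> 0 <= zeta -> 0 <= rho <= L ->
    (1 <= n)%N -> (2 <= tau)%N -> (1 <= rounds)%N ->
  exists eta : R, 0 < eta /\
  forall (d : nat) (f : 'I_n -> 'rV[R]_d -> R) (x0 : 'rV[R]_d)
    (dO dX : measure_display) (Omega : measurableType dO)
    (P : probability Omega R) (Xi : 'I_n -> measurableType dX)
    (xi : forall i : 'I_n, nat -> {RV P >-> Xi i})
    (G : forall i : 'I_n, 'rV[R]_d -> Xi i -> 'rV[R]_d)
    (x : nat -> 'I_n -> Omega -> 'rV[R]_d),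
    let T := (tau * rounds)%N in
    (forall i : 'I_n, lipschitz_gradient L (f i)) ->
    has_lbound (range (avg_fun f)) ->
    Delta = avg_fun f x0 - inf (range (avg_fun f)) ->
    grad_similarity zeta f ->
    (forall i : 'I_n, weakly_convex rho (f i)) ->
    stochastic_oracle T xi f G sigma ->
    LocalSGD tau T eta xi G x0 x ->
    ((T%:R^-1)%:E *
       \sum_(0 <= t < T) 'E_P[fun w => sqnorm2 (grad (avg_fun f) (worker_mean x t w))]
     <= (C * ((L / tau%:R + rho) * (Delta / rounds%:R)
              + Num.sqrt (L * Delta * sigma ^+ 2 / (n%:R * tau%:R * rounds%:R))
              + (L * Delta * zeta / rounds%:R) `^ (2 / 3)
              + (L * Delta * sigma) `^ (2 / 3)
                / (tau%:R `^ (1 / 3) * rounds%:R `^ (2 / 3))))%:E)%E.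
Proof.
exists (8 + 2 * expR 2); split; first by rewrite addr_gt0// mulr_gt0// expR_gt0.
move=> L Delta sigma zeta rho n tau rounds L0 D0 s0 z0 rL n0 tau2 rounds0.
have r0 : 0 <= rho by case/andP: rL.
have tau0 : (0 < tau)%N by exact: leq_trans tau2.
exists (stepsize L Delta sigma zeta rho n tau rounds).
split; first exact: stepsize_gt0.
move=> d f x0 dO dX Omega P Xi xi G x T lf lb DE sim wc [mG [_ ind] hmean hvar] sgd.
set eta := stepsize _ _ _ _ _ _ _ _ in sgd.
have L1' := ltW L0.
have df y i : differentiable (f i) y by exact: (lf i).1.
have e0 : 0 < eta by exact: stepsize_gt0.
have eL : 4 * L * eta <= 1 by exact: stepsizeL.
have er : 4 * rho * eta * tau%:R <= 1 by exact: stepsize_rho.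
have gFE y : grad (avg_fun f) y = vavg (fun i => grad (f i) y).
  by rewrite grad_avg// => i.
have gf_lip i y z : sqnorm2 (grad (f i) y - grad (f i) z) <= L ^+ 2 * sqnorm2 (y - z).
  by exact: lipschitz_gradient_sqr L1' (lf i).
have gf_coco i y z := weakly_cocoercive y z L0 rL (lf i) (wc i).
have gf_sim y : n%:R^-1 * \sum_i sqnorm2 (grad (f i) y - grad (avg_fun f) y) <= zeta ^+ 2.
  by rewrite -lee_fin; apply: le_trans sim; apply: ereal_sup_ubound; exists y.
have F_desc y v := descent_avg y v L0 lf n0.
have F_low y : inf (range (avg_fun f)) <= avg_fun f y by apply: ge_inf => //; exists y.
have F_cont : continuous (avg_fun f).
  by move=> y; apply: differentiable_continuous; apply: differentiable_avg => i; exact: df.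
have hmean' i t y : (t < T)%N -> has_mean P (fun w => G i y (xi i t w)) (grad (f i) y).
  exact: hmean.
have hvar' i t y : (t < T)%N ->
    ('E_P[fun w => sqnorm2 (G i y (xi i t w) - grad (f i) y)] <= (sigma ^+ 2)%:E)%E.
  exact: hvar.
(* The stepsize was chosen before the data of the problem; the recursions apply
   with [inf (range (avg_fun f))] as the lower bound of the average. *)
have main := sum_mean_sqnorm2_grad n0 sgd mG ind hmean' hvar' L0 r0 e0 tau2 eL er
  gFE gf_lip gf_coco gf_sim F_desc F_low F_cont.
have EE t : (t < T)%N -> _ :=
  fun tT => expectation_sqnorm2_grad sgd mG ind hvar' gFE gf_lip (ltnW tT).
rewrite big_mkord (eq_bigr _ (fun (t : 'I_T) _ => EE t (ltn_ord t))) sumEFin -EFinM lee_fin.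
apply: le_trans (stepsize_rate L0 D0 s0 z0 r0 n0 tau0 rounds0).
apply: ler_wpM2l; first by rewrite invr_ge0.
by rewrite [in X in _ <= _ * X + _]DE.
Qed.
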